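(* When $n=2$, the volume of every 2-simplex $\Sigma$ in the outer space $X_2$ with respect to the Riemannian metric $ds^2=\Pi^*(ds_{inv}^2)+ds_0^2$ is finite, and hence the volume of $\mathrm{Out}(F_2)\backslash X_2$ with respect to the Riemannian metric $ds^2$ is finite.
   Context: Outer space (for general $n\ge2$; here $n=2$). Graphs $G$ are finite connected graphs (loops and multiple edges allowed) with $\pi_1(G)\cong F_n$, with no vertex of valence 1 or 2 and no separating edge. A metric graph $(G,\ell)$ is such a graph with a length $\ell(e)>0$ for each edge, normalized by $\sum_e \ell(e)=1$. Let $R_n$ be the wedge of $n$ circles. A marking is a homotopy equivalence $h:G\to R_n$. Marked metric graphs are equivalent if there is an isometry between them commuting with the markings up to homotopy. $X_n$ is the set of equivalence classes. $\mathrm{Out}(F_n)$, identified with the group of homotopy classes of self homotopy equivalences $\varphi$ of $R_n$, acts by $\varphi\cdot(G,\ell,h)=(G,\ell,\varphi\circ h)$. Simplices. For a marked graph $(G,h)$ with edges $e_1,\dots,e_k$, varying $x_i=\ell(e_i)$ gives an open $(k-1)$-simplex $\Sigma_{(G,h)}=\{x\in\mathbb R^k: x_i>0,\ \sum x_i=1\}$ in $X_n$. $X_n$ is the disjoint union of these open simplices, and is a simplicial complex with some faces missing (a face obtained by letting some edge lengths be $0$ belongs to $X_n$ if and only if the union of those edges contains no homotopically nontrivial loop). Period map. On $C_1(G,\mathbb R)$ (edges oriented) let $Q(e,e)=\ell(e)$ and $Q(e,e')=0$ for distinct edges. The restriction of $Q$ to $H_1(G,\mathbb R)$ is positive definite,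 and via $h_*:H_1(G,\mathbb Z)\cong H_1(R_n,\mathbb Z)=\mathbb Z^n$ it becomes a positive definite symmetric $n\times n$ matrix $\Pi(G,\ell,h)$, a point of $\mathrm{GL}(n,\mathbb R)/\mathrm{O}(n)$ (identified with the space of positive definite symmetric matrices $Y$, with action $g\cdot Y=gYg^t$). $ds_{inv}^2$ is a fixed $\mathrm{GL}(n,\mathbb R)$-invariant Riemannian metric on this space; concretely $ds^2_{inv}=\mathrm{Tr}((Y^{-1}dY)^2)$. Metric and volume. On each open simplex $\Sigma\subset\mathbb R^k$, $ds_0^2$ is the flat metric induced from $\mathbb R^k$ and $ds^2=\Pi^*(ds_{inv}^2)+ds_0^2$, a Riemannian metric on $\Sigma$. The volume of a simplicial complex with a piecewise Riemannian metric is the sum of the volumes of its top-dimensional simplices; for $\mathrm{Out}(F_n)\backslash X_n$ these are the top-dimensional simplices of $X_n$ modulo $\mathrm{Out}(F_n)$, of which there are finitely many orbits. *)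

(* Defs.v *)
From HB Require Import structures.
From mathcomp Require Import all_boot all_order all_algebra.
From mathcomp Require Import all_classical all_reals all_analysis.
Import Order.TTheory GRing.Theory Num.Theory.
Import numFieldNormedType.Exports.

Set Implicit Arguments.
Unset Strict Implicit.
Unset Printing Implicit Defensive.

Local Open Scope classical_set_scope.
Local Open Scope ring_scope.
Local Open Scope quotient_scope.

(** * Finite graphs, loops and multiple edges allowed *)

(* Every edge carries an arbitrary orientation; the vertex and edge sets are
   labelled by ordinals, which loses nothing up to isomorphism. *)
Record graph := Graph {
  nV : nat;
  nE : nat;
  src : 'I_nE -> 'I_nV;
  tgt : 'I_nE -> 'I_nV
}.

Definition rose (n : nat) : graph :=
  @Graph 1 n (fun=> ord0) (fun=> ord0).

Section Combinatorics.
Variable G : graph.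

Definition adj (P : pred 'I_(nE G)) : rel 'I_(nV G) := fun u v =>
  [exists e, P e && (((src e == u) && (tgt e == v))
                  || ((src e == v) && (tgt e == u)))].

Definition connected_along (P : pred 'I_(nE G)) : bool :=
  [forall u, forall v, fingraph.connect (adj P) u v].

Definition graph_connected : bool := (0 < nV G)%N && connected_along predT.

Definition separating (e : 'I_(nE G)) : bool := ~~ connected_along (predC1 e).

(* a loop contributes 2 to the valence of its vertex *)
Definition valence (v : 'I_(nV G)) : nat :=
  (#|[set e | src e == v]%SET| + #|[set e | tgt e == v]%SET|)%N.

(* The condition that the fundamental group is free of rank n is not repeated
   here: it is part of the existence of a marking, see [marking]. *)
Definition admissible : Prop :=
  [/\ graph_connected,
      (forall v, valence v <> 1%N /\ valence v <> 2%N) &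
      (forall e, ~~ separating e)].

End Combinatorics.

(** * Topological realization *)

(* unit interval, with the topology induced from R *)
Notation I01 R := (set_type [set` `[0 : R, 1]]).

Section Interval.
Variable R : realType.

Lemma in01_0 : (0 : R) \in [set` `[0 : R, 1]].
Proof. by rewrite inE /= in_itv /= lexx ler01. Qed.

Lemma in01_1 : (1 : R) \in [set` `[0 : R, 1]].
Proof. by rewrite inE /= in_itv /= lexx ler01. Qed.

Definition I0 : I01 R := exist _ 0 in01_0.
Definition I1 : I01 R := exist _ 1 in01_1.
Definition i01val (t : I01 R) : R := set_val t.

End Interval.

Section Realization.
Variables (R : realType) (G : graph).

(* The realization is a quotient of the disjoint union of one copy of [0,1] per
   edge.  For a connected graph with at least one edge (every marked graph of
   rank at least 1) there is no need for separate 0-cells. *)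
Local Notation cells := {e : 'I_(nE G) & I01 R}.

(* the vertex to which a point of a closed edge is glued, if any *)
Definition end_vertex (x : cells) : option 'I_(nV G) :=
  let: existT e t := x in
  if t == I0 R then Some (src e) else if t == I1 R then Some (tgt e) else None.

Definition glued (x y : cells) : bool :=
  (x == y) || (end_vertex x && (end_vertex x == end_vertex y)).

Lemma glued_refl : reflexive glued.
Proof. by move=> x; rewrite /glued eqxx. Qed.

Lemma glued_sym : symmetric glued.
Proof.
move=> x y; rewrite /glued eq_sym [end_vertex y == _]eq_sym.
by case: eqP => [->|] //=; case: eqP => [->|] //; rewrite !andbF.
Qed.

Lemma glued_trans : transitive glued.
Proof.
move=> y x z /predU1P[->//|/andP[hx /eqP xy]] /predU1P[<-|/andP[hy /eqP yz]];
  by apply/orP; right; rewrite hx ?xy ?yz eqxx.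
Qed.

Canonical glued_equiv := EquivRel glued glued_refl glued_sym glued_trans.

Definition realization := {eq_quot glued_equiv}.
HB.instance Definition _ := Quotient.on realization.
HB.instance Definition _ :=
  Topological.copy realization (quotient_topology realization).

Definition on_edge (e : 'I_(nE G)) (t : I01 R) : realization :=
  \pi_realization (existT _ e t).

(* Length metric: infimum of the lengths of the finite chains of segments, each
   contained in a closed edge. *)
Inductive chain_length (l : 'rV[R]_(nE G)) :
    realization -> realization -> R -> Prop :=
| chain_nil x : chain_length l x x 0
| chain_cons e (s t : I01 R) y r : chain_length l (on_edge e t) y r ->
    chain_length l (on_edge e s) y (l 0 e * `|i01val s - i01val t| + r).

Definition graph_dist (l : 'rV[R]_(nE G)) (x y : realization) : R :=
  inf [set r | chain_length l x y r].

End Realization.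

(** * Homotopy *)

Section Homotopy.
Variable R : realType.

Definition homotopic (X Y : topologicalType) (f g : X -> Y) : Prop :=
  exists2 H : X * I01 R -> Y, continuous H &
    forall x, H (x, I0 R) = f x /\ H (x, I1 R) = g x.

Definition homotopy_equivalence (X Y : topologicalType) (f : X -> Y) : Prop :=
  continuous f /\
  exists g : Y -> X, [/\ continuous g,
    homotopic (g \o f) idfun & homotopic (f \o g) idfun].

End Homotopy.

(** * Outer space *)

Section OuterSpace.
Variables (R : realType) (n : nat).

Local Notation Rn := (realization R (rose n)).

Definition marking (G : graph) (h : realization R G -> Rn) : Prop :=
  homotopy_equivalence R h.

Definition marked_graph (G : graph) (h : realization R G -> Rn) : Prop :=
  admissible G /\ marking h.

Definition open_simplex (k : nat) : set 'rV[R]_k :=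
  [set x | (forall i, 0 < x 0 i) /\ \sum_i x 0 i = 1].

Record metric_triple := MetricTriple {
  mt_graph : graph;
  mt_len : 'rV[R]_(nE mt_graph);
  mt_map : realization R mt_graph -> Rn
}.

Definition marked_metric_graph (m : metric_triple) : Prop :=
  marked_graph (@mt_map m) /\ open_simplex (mt_len m).

(* A bijection preserving the length metrics is automatically a homeomorphism;
   bicontinuity is recorded only for convenience. *)
Definition isometry (G G' : graph) (l : 'rV[R]_(nE G)) (l' : 'rV[R]_(nE G'))
    (f : realization R G -> realization R G') : Prop :=
  continuous f /\
  (exists g : realization R G' -> realization R G,
    [/\ continuous g, cancel f g & cancel g f]) /\
  forall x y, graph_dist l' (f x) (f y) = graph_dist l x y.

Definition equivalent (m m' : metric_triple) : Prop :=
  exists2 f : realization R (mt_graph m) -> realization R (mt_graph m'),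
    isometry (mt_len m) (mt_len m') f &
    homotopic R (@mt_map m' \o f) (@mt_map m).

Definition outer_point (m : metric_triple) : set metric_triple :=
  [set m' | marked_metric_graph m' /\ equivalent m m'].

Definition outer_space : set (set metric_triple) :=
  [set outer_point m | m in marked_metric_graph].

Definition simplex (G : graph) (h : realization R G -> Rn) :
    set (set metric_triple) :=
  [set outer_point (MetricTriple l h) | l in @open_simplex (nE G)].

(* The elements of Out(F_n) are the homotopy classes of these maps. *)
Definition self_equivalences : set (Rn -> Rn) :=
  [set phi | homotopy_equivalence R phi].

Definition act (phi : Rn -> Rn) (m : metric_triple) : metric_triple :=
  MetricTriple (mt_len m) (phi \o @mt_map m).

Definition out_act (phi : Rn -> Rn) (p : set metric_triple) :
    set metric_triple :=
  \bigcup_(m in p) outer_point (act phi m).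

Definition simplex_orbit (S : set (set metric_triple)) :
    set (set (set metric_triple)) :=
  [set [set out_act phi p | p in S] | phi in self_equivalences].

(** * Period map *)

(* Angular coordinate of a point of R_n along the i-th circle, the other circles
   being collapsed to the base point.  It is well defined modulo 1 only: on the
   base point it is 0 or 1 according to the representative. *)
Definition angle (i : 'I_n) (y : Rn) : R :=
  let: existT e t := (repr y : {e : 'I_(nE (rose n)) & I01 R}) in
  if e == i then i01val t else 0.

(* total variation a(1) - a(0) of a continuous lift a of this angle along a path;
   a lift exists for every path and any two of them differ by an integer *)
Definition turning (i : 'I_n) (gamma : I01 R -> Rn) : R :=
  xget 0 [set d | exists a : I01 R -> R,
    [/\ continuous a,
        (forall t, a t - angle i (gamma t) \is a Num.int) &
        d = a (I1 R) - a (I0 R)]].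

Section Period.
Variables (G : graph) (h : realization R G -> Rn).

(* H_1(G, Z), the kernel of the boundary map on Z-linear combinations of edges *)
Definition cycles : set 'rV[int]_(nE G) :=
  [set c | forall v : 'I_(nV G),
    \sum_(e | tgt e == v) c 0 e = \sum_(e | src e == v) c 0 e].

(* h_* : H_1(G, Z) -> H_1(R_n, Z) = Z^n, with values in Z^n inside R^n: the i-th
   coordinate is the degree of the cycle on the i-th circle. *)
Definition h_push (c : 'rV[int]_(nE G)) : 'rV[R]_n :=
  \row_i \sum_e (c 0 e)%:~R * turning i (h \o @on_edge R G e).

(* inverse image under h_* of the i-th vector of the standard basis *)
Definition basis_cycle (i : 'I_n) : 'rV[int]_(nE G) :=
  xget 0 [set c | cycles c /\ h_push c = delta_mx 0 i].

Definition length_form (l : 'rV[R]_(nE G)) (c d : 'rV[int]_(nE G)) : R :=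
  \sum_e l 0 e * (c 0 e)%:~R * (d 0 e)%:~R.

Definition period (l : 'rV[R]_(nE G)) : 'M[R]_n :=
  \matrix_(i, j) length_form l (basis_cycle i) (basis_cycle j).

(** * The metric and its volume *)

Definition dperiod (l u : 'rV[R]_(nE G)) : 'M[R]_n :=
  \matrix_(i, j) derive1 (fun t : R => period (l + t *: u) i j) 0.

(* polarization of Tr ((Y^-1 dY)^2) *)
Definition ds2_inv (Y A B : 'M[R]_n) : R :=
  \tr (invmx Y *m A *m (invmx Y *m B)).

Definition ds2 (l u w : 'rV[R]_(nE G)) : R :=
  ds2_inv (period l) (dperiod l u) (dperiod l w) + \sum_e u 0 e * w 0 e.

(* Parametrization (s, t) |-> (s, t, 1 - s - t) of the plane of the 2-simplex and
   its coordinate frame; meant for three edges. *)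
Definition chart (p : R * R) : 'rV[R]_(nE G) :=
  \row_i nth 0 [:: p.1; p.2; 1 - p.1 - p.2] i.

Definition frame (a : 'I_2) : 'rV[R]_(nE G) :=
  \row_i nth 0 (if a == 0 then [:: 1; 0; -1] else [:: 0; 1; -1]) i.

Definition area : \bar R :=
  (\int[(@lebesgue_measure R \x @lebesgue_measure R)%E]_(p in
        [set p | open_simplex (chart p)])
     (Num.sqrt (\det (\matrix_(a < 2, b < 2)
        ds2 (chart p) (frame a) (frame b))))%:E)%E.

End Period.

Definition two_simplices : set (set (set metric_triple)) :=
  [set S | exists G (h : realization R G -> Rn),
    [/\ nE G = 3%N, marked_graph h & S = simplex h]].

(* The area does not depend on the marked graph (G, h) used to describe a
   simplex, nor on the simplex inside an orbit (Out(F_n) acts by isometries), so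
   the two suprema below range over one-element sets. *)
Definition simplex_area (S : set (set metric_triple)) : \bar R :=
  ereal_sup [set x | exists G (h : realization R G -> Rn),
    [/\ nE G = 3%N, marked_graph h, S = simplex h & x = area h]].

Definition orbit_area (O : set (set (set metric_triple))) : \bar R :=
  ereal_sup [set simplex_area S | S in O].

End OuterSpace.

(* Volume of Out(F_2) \ X_2: the top-dimensional simplices of X_2 are its
   2-simplices (a marked graph of rank n has at most 3n - 3 edges). *)
Definition quotient_volume (R : realType) : \bar R :=
  (\esum_(O in [set simplex_orbit S | S in @two_simplices R 2])
     orbit_area O)%E.

(* Main.v *)
Require Import Defs.
From mathcomp Require Import all_boot all_order all_algebra.
From mathcomp Require Import all_classical all_reals all_analysis.
From mathcomp Require Import measurable_realfun ring lra zify.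
Import Order.TTheory GRing.Theory Num.Theory.
Import numFieldNormedType.Exports.

Set Implicit Arguments.
Unset Strict Implicit.
Unset Printing Implicit Defensive.

Local Open Scope classical_set_scope.
Local Open Scope ring_scope.
Local Open Scope quotient_scope.

(** A marking enters the period matrix only through a change of basis of the
homology, and the invariant metric does not see it. So the area of a simplex
depends on the graph alone, there is one graph type to integrate over, and
there are finitely many orbits because Out(F_2) acts transitively on the
markings of a given graph.

Shape of the graph. A marking h has a homotopy inverse g. Winding numbers of
closed paths are homotopy invariant ([wind_homotopy]), and along a closed path
in a graph they are linear in the windings of the path along the edges, which
form an integral cycle ([wind_loop], [wind_boundary]). Applied to h o g this
gives cycles mapped by h to the standard basis ([marking_cycle]); applied to
g o h it shows that a graph with a single vertex has at most n edges
([marked_rose_edges]). Hence a marked graph of rank 2 with three edges has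
several vertices, and being admissible it is a theta graph
([admissible_theta]): two vertices joined by three edges.

The metric. Let x, y, z be the lengths of the three edges, x + y + z = 1.
In a suitable basis the period matrix is ((x + z, z), (z, y + z))
([period_theta]). With D = xy + yz + zx its determinant, the invariant part of
the metric is minus the Hessian of log D, namely
(dD)^2 / D^2 - (Hess D) / D ([ds2_inv_theta]). The most singular term has rank
one, so that the determinant of the metric is O(D^-3) instead of O(D^-4)
([theta_gram_le]), and the area density is O(D^(-3/2)). This is what makes
the cusps, where D tends to 0 linearly, integrable.

The integral. Since D = x (1 - x) + yz is at least x (1 - x), and likewise at
least y (1 - y), the density is bounded by a constant times
(x (1 - x))^(-3/4) (y (1 - y))^(-3/4), a product of two integrable functions
of one variable ([sqrt_theta_gram_le], [integral_edge_weight]).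

The orbits. If h and k are markings of the same graph and g is a homotopy
inverse of h, then k o g is a self equivalence of the rose that carries h to k
up to homotopy; so the orbit of a simplex is the set of all simplices on its
graph ([simplex_orbitE]). *)

(** * Circle-valued functions *)

Section Circle.
Variable R : realType.
Implicit Types x y : R.

(** Coordinates of the embedding of R/Z as the unit circle. *)
Definition ccos x : R := cos (pi *+ 2 * x).
Definition csin x : R := sin (pi *+ 2 * x).

Lemma ccosD x y : ccos (x + y) = ccos x * ccos y - csin x * csin y.
Proof. by rewrite /ccos mulrDr cosD. Qed.

Lemma csinD x y : csin (x + y) = csin x * ccos y + ccos x * csin y.
Proof. by rewrite /csin mulrDr sinD. Qed.

Lemma ccosN x : ccos (- x) = ccos x.
Proof. by rewrite /ccos mulrN cosN. Qed.

Lemma csinN x : csin (- x) = - csin x.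
Proof. by rewrite /csin mulrN sinN. Qed.

Lemma ccosB x y : ccos (x - y) = ccos x * ccos y + csin x * csin y.
Proof. by rewrite ccosD ccosN csinN mulrN opprK. Qed.

Lemma csinB x y : csin (x - y) = csin x * ccos y - ccos x * csin y.
Proof. by rewrite csinD ccosN csinN mulrN. Qed.

Lemma ccos_sin x : ccos x ^+ 2 + csin x ^+ 2 = 1.
Proof. exact: cos2Dsin2. Qed.

Lemma ccos_csin_int x : x \is a Num.int -> ccos x = 1 /\ csin x = 0.
Proof.
have E1 : ccos 1 = 1 /\ csin 1 = 0.
  by rewrite /ccos /csin mulr1 cos2pi sin2pi.
have En n : ccos n%:R = 1 /\ csin n%:R = 0.
  elim: n => [|n [IHc IHs]]; first by rewrite /ccos /csin mulr0 cos0 sin0.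
  by rewrite -natr1 ccosD csinD IHc IHs !(E1.1, E1.2); split; ring.
rewrite intrE => /orP[/natrP[n ->]|/natrP[n xn]]; first exact: En.
by have [c s] := En n; rewrite -[x]opprK xn ccosN csinN c s oppr0.
Qed.

Lemma ccos_eq1 x : ccos x = 1 -> x \is a Num.int.
Proof.
move=> cx1; set n := Num.floor x.
have /ccos_csin_int[cn sn] : n%:~R \is a @Num.int R by exact: intr_int.
have c1 : ccos (x - n%:~R) = 1 by rewrite ccosB cn sn cx1; ring.
have /andP[r0 r1] : 0 <= x - n%:~R < 1.
  by have := floor_itv x; rewrite intrD1 subr_ge0 ltrBlDl.
have s0 : sin (pi * (x - n%:~R)) = 0.
  have := c1; rewrite /ccos mulrnAl cos_mulr2n => /eqP.
  rewrite cos2sin2 -subr_eq0 => /eqP e.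
  by apply/eqP; rewrite -sqrf_eq0; apply/eqP; move: e; lra.
suff /eqP : x - n%:~R = 0 by rewrite subr_eq0 => /eqP ->; exact: intr_int.
apply/eqP; rewrite eq_le r0 andbT leNgt; apply/negP => rp.
have : 0 < sin (pi * (x - n%:~R)); last by rewrite s0 ltxx.
apply: sin_gt0_pi; rewrite mulr_gt0 ?pi_gt0 //= -subr_gt0.
by rewrite -[X in X - _]mulr1 -mulrBr mulr_gt0 ?pi_gt0 ?subr_gt0.
Qed.

(** Within a quarter turn of an integer, the signed distance to that integer;
the formula makes its continuity there evident. *)
Definition residue x : R := asin (csin x) / (pi *+ 2).

Lemma residue0 : residue 0 = 0.
Proof.
rewrite /residue /csin mulr0 sin0 -[X in asin X]sin0 sinK ?mul0r //.
by rewrite in_itv/= oppr_le0 andbb divr_ge0 ?pi_ge0.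
Qed.

Lemma residue_int x : 0 < ccos x -> residue x - x \is a Num.int.
Proof.
move=> cx; have s1 : -1 <= csin x <= 1 by rewrite sin_geN1 sin_le1.
have p0 : pi *+ 2 != 0 :> R by rewrite mulrn_eq0 /= gt_eqF ?pi_gt0.
have rE : pi *+ 2 * residue x = asin (csin x) by rewrite mulrC divfK.
apply: ccos_eq1; rewrite ccosB {1}/ccos {1}/csin rE cos_asin // asinK ?in_itv //.
have -> : 1 - csin x ^+ 2 = ccos x ^+ 2 by rewrite -(ccos_sin x); ring.
by rewrite sqrtr_sqr gtr0_norm // -!expr2 ccos_sin.
Qed.

Section Topo.
Variable X : topologicalType.

(** Continuity of a function into R/Z that is given by real representatives. *)
Definition circular (theta : X -> R) : Prop :=
  continuous (ccos \o theta) /\ continuous (csin \o theta).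

Lemma continuous_circular (f : X -> R) : continuous f -> circular f.
Proof.
have M (g : R -> R) : continuous g -> continuous f ->
    continuous (fun u => g (pi *+ 2 * f u)).
  move=> cg cf x; apply: continuous_comp; last exact: cg.
  by apply: cvgM; [exact: cvg_cst|exact: cf].
by move=> cf; split; apply: M => //; [exact: continuous_cos|exact: continuous_sin].
Qed.

Lemma circularB (f g : X -> R) :
  circular f -> circular g -> circular (fun u => f u - g u).
Proof.
move=> [cf sf] [cg sg]; split=> x.
- rewrite /comp; under eq_fun do rewrite ccosB.
  by apply: cvgD; apply: cvgM; [exact: cf|exact: cg|exact: sf|exact: sg].
- rewrite /comp; under eq_fun do rewrite csinB.
  by apply: cvgB; apply: cvgM; [exact: sf|exact: cg|exact: cf|exact: sg].
Qed.

Lemma residue_continuous (f : X -> R) : circular f ->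
  (forall u, 0 < ccos (f u)) -> continuous (residue \o f).
Proof.
move=> [cf sf] f0 x; apply: cvgMl; apply: (@continuous_comp _ _ _ (csin \o f)).
  exact: sf.
apply: continuous_asin => /=.
have := ccos_sin (f x); have := exprn_gt0 2 (f0 x).
by move: (csin _) (ccos _ ^+ 2) => s c c0 cs; apply/andP; split; nra.
Qed.
End Topo.

Lemma circular_comp (X Y : topologicalType) (f : X -> Y) (theta : Y -> R) :
  continuous f -> circular theta -> circular (theta \o f).
Proof.
move=> cf [ct st]; split=> x.
- by apply: (@continuous_comp _ _ _ f (ccos \o theta)); [exact: cf|exact: ct].
- by apply: (@continuous_comp _ _ _ f (csin \o theta)); [exact: cf|exact: st].
Qed.
End Circle.
Arguments ccos {R}.
Arguments csin {R}.
Arguments residue {R}.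

(** * Lifting paths and squares to the line *)

Section Lifting.
Variable R : realType.

Lemma fst_continuous (X Y : topologicalType) : continuous (@fst X Y).
Proof. by move=> [x y]; exact: cvg_fst. Qed.

Lemma snd_continuous (X Y : topologicalType) : continuous (@snd X Y).
Proof. by move=> [x y]; exact: cvg_snd. Qed.

Lemma pair_continuous (X Y Z : topologicalType) (f : X -> Y) (g : X -> Z) :
  continuous f -> continuous g -> continuous (fun x => (f x, g x)).
Proof. by move=> cf cg x; apply: cvg_pair => /=; [exact: cf|exact: cg]. Qed.

Lemma comp_continuous (X Y Z : topologicalType) (f : X -> Y) (g : Y -> Z) :
  continuous f -> continuous g -> continuous (g \o f).
Proof. by move=> cf cg x; apply: continuous_comp; [exact: cf|exact: cg]. Qed.

Lemma addr_continuous (X : topologicalType) (f g : X -> R) :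
  continuous f -> continuous g -> continuous (fun x => f x + g x).
Proof. by move=> cf cg x; apply: cvgD; [exact: cf|exact: cg]. Qed.

Lemma mull_continuous (X : topologicalType) (c : R) (f : X -> R) :
  continuous f -> continuous (fun x => c * f x).
Proof. by move=> cf x; apply: cvgM; [exact: cvg_cst|exact: cf]. Qed.

Lemma clamp_subproof (t : R) : Num.max 0 (Num.min 1 t) \in [set` `[0 : R, 1]].
Proof. by rewrite inE /= in_itv /= le_max lexx /= ge_max ler01 ge_min lexx. Qed.

(** A retraction of the line onto the unit interval: it lets functions on the
interval be treated as functions on the line. *)
Definition clamp (t : R) : I01 R :=
  exist (fun x => x \in [set` `[0 : R, 1]]) _ (clamp_subproof t).

Lemma i01val_itv (t : I01 R) : 0 <= i01val t <= 1.
Proof. by have := set_valP t; rewrite /= in_itv. Qed.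

Lemma clampK (t : I01 R) : clamp (i01val t) = t.
Proof.
apply: val_inj => /=; have /andP[t0 t1] := i01val_itv t.
by rewrite (min_idPr t1) (max_idPr t0).
Qed.

Lemma clamp0 : clamp 0 = I0 R. Proof. exact: (clampK (I0 R)). Qed.
Lemma clamp1 : clamp 1 = I1 R. Proof. exact: (clampK (I1 R)). Qed.

Lemma i01val_continuous : continuous (@i01val R).
Proof. exact: initial_continuous. Qed.

Lemma clamp_continuous : continuous clamp.
Proof.
apply: continuous_comp_initial.
have -> : set_val \o clamp = (fun=> 0 : R) \max ((fun=> 1 : R) \min id).
  by apply/funext.
move=> x; apply: continuous_max; first exact: cst_continuous.
by apply: continuous_min; [exact: cst_continuous|exact: cvg_id].
Qed.

Lemma clamp_lip (s t : R) : s <= t -> 0 <= i01val (clamp t) - i01val (clamp s) <= t - s.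
Proof.
have clampE u : i01val (clamp u) = if u < 0 then 0 else if 1 < u then 1 else u.
  have -> : i01val (clamp u) = Num.max 0 (Num.min 1 u) by [].
  rewrite /Order.max /Order.min.
  by case: (ltP 1 u) => ?; case: (ltP u 0) => ?; case: ifP => ?; lra.
move=> st; rewrite !clampE.
by case: (ltP s 0) => ?; case: (ltP 1 s) => ?; case: (ltP t 0) => ?; case: (ltP 1 t) => ?;
   apply/andP; split; lra.
Qed.

Lemma int_continuous_const (f : R -> R) : continuous f ->
  (forall t : I01 R, f (i01val t) \is a Num.int) -> f 0 = f 1.
Proof.
move=> cf fint; apply/eqP/negPn/negP => f01.
have [n0 e0] : exists n, f 0 = n%:~R by apply/intrP; exact: (fint (I0 R)).
have [n1 e1] : exists n, f 1 = n%:~R by apply/intrP; exact: (fint (I1 R)).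
wlog : f cf fint f01 n0 n1 e0 e1 / f 0 < f 1 => [W|lt01].
  have := f01; rewrite neq_lt => /orP[|lt10]; first exact: (W f cf fint f01 n0 n1).
  apply: (W (fun t => - f t) _ _ _ (- n0) (- n1)).
  - by move=> x; apply: cvgN; exact: cf.
  - by move=> t; rewrite rpredN.
  - by rewrite eqr_opp.
  - by rewrite e0 mulrNz.
  - by rewrite e1 mulrNz.
  - by rewrite ltrN2.
have [//|||c + fc] := @IVT R f 0 1 (f 0 + 2^-1).
- exact/continuous_subspaceT.
- (* f 0 + 1/2 is not an integer, yet it lies between the two integer values *)
  rewrite (min_idPl (ltW lt01)) (max_idPr (ltW lt01)).
  move: lt01; rewrite e0 e1 ltr_int -lezD1 -(ler_int R) intrD => le01.
  by apply/andP; split; lra.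
- rewrite in_itv /= => /andP[c0 c1].
have cin : c \in [set` `[0 : R, 1]] by rewrite inE /= in_itv /= c0.
have [m] := intrP (fint (exist _ c cin)).
rewrite (_ : f _ = f 0 + 2^-1) // e0 => /eqP; rewrite -subr_eq0 => h.
have : (2 * (n0 - m) + 1)%:~R = 0 :> R.
  by move: h; rewrite intrD intrM intrB => /eqP h; lra.
move/eqP; rewrite intr_eq0 => /eqP; lia.
Qed.

(** Uniform continuity on the compact square, in the form that is needed: for a
small horizontal step the value turns by less than a quarter. *)
Lemma circular_subdivision (theta : I01 R * I01 R -> R) : circular theta ->
  exists N : nat, forall s s' t : R, s <= s' <= s + N.+1%:R^-1 ->
    0 < ccos (theta (clamp s', clamp t) - theta (clamp s, clamp t)).
Proof.
move=> cth.
pose K : set (R * R) := `[0, 1] `*` `[0, 1].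
have cK : compact K by apply: compact_setX; exact: segment_compact.
pose P (d : R) (p : R * R) :=
  0 < ccos (theta (clamp (p.1 + d), clamp p.2) - theta (clamp p.1, clamp p.2)).
have /(_ R (nbhs (0 : R)) P _) [] := (compact_near_coveringP K).1 cK.
  move=> p Kp.
  pose h (q : (R * R) * R) := theta (clamp (q.1.1 + q.2), clamp q.1.2)
                            - theta (clamp q.1.1, clamp q.1.2).
  have ch : circular h.
    have cc (f g : (R * R) * R -> R) : continuous f -> continuous g ->
        circular (fun q => theta (clamp (f q), clamp (g q))).
      move=> cf cg.
      apply: (@circular_comp _ _ _ (fun q => (clamp (f q), clamp (g q)))) => //.
      by apply: pair_continuous; apply: comp_continuous clamp_continuous.
    have c11 : continuous (fun q : (R * R) * R => q.1.1).
      by apply: (comp_continuous (@fst_continuous _ _)); exact: fst_continuous.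
    have c12 : continuous (fun q : (R * R) * R => q.1.2).
      by apply: (comp_continuous (@fst_continuous _ _)); exact: snd_continuous.
    apply: circularB; apply: cc => //.
    by move=> q; apply: cvgD; [exact: c11|exact: snd_continuous].
  have : (ccos \o h) q @[q --> (p, 0 : R)] --> (ccos \o h) (p, 0) by exact: ch.1.
  have h0 : 0 < (ccos \o h) (p, 0).
    by rewrite /h /= addr0 subrr /ccos mulr0 cos0.
  by move=> /(_ _ (lt_nbhsr h0)).
move=> e /= e0 He.
have [N _ /(_ N (leqnn _)) /= HN] := near_infty_natSinv_lt (PosNum e0).
exists N => s s' t /andP[ss' s'N].
pose cs := i01val (clamp s); pose d := i01val (clamp s') - cs.
have /andP[d0 d1] := clamp_lip ss'.
have /(He d)/(_ (cs, i01val (clamp t))) : ball_ Num.norm (0 : R) e d.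
  rewrite /= sub0r normrN ger0_norm //.
  by apply: le_lt_trans d1 _; apply: le_lt_trans HN; rewrite lerBlDl.
have csd : cs + d = i01val (clamp s') by rewrite /d addrC subrK.
rewrite /P /= csd !clampK; apply.
by split; rewrite /= in_itv /=; exact: i01val_itv.
Qed.

(** Over a square, the change of a circular function along the horizontal
segments has a continuous real representative: subdivide so finely that the
change over one step is less than a quarter turn, and add up residues. *)
Lemma sweep (theta : I01 R * I01 R -> R) : circular theta ->
  exists2 A : R * R -> R, continuous A & forall s t : I01 R,
    A (0, i01val t) = 0 /\
    A (i01val s, i01val t) - (theta (s, t) - theta (I0 R, t)) \is a Num.int.
Proof.
move=> cth; have [N HN] := circular_subdivision cth.
pose cut k (s : R) := Num.min s (k%:R / N.+1%:R).
pose th s t := theta (clamp s, clamp t).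
(* the change of theta over the k-th step, for paths stopped at p.1 *)
pose dth k (p : R * R) := th (cut k.+1 p.1) p.2 - th (cut k p.1) p.2.
have dth_gt0 k p : 0 < ccos (dth k p).
  apply: HN; rewrite /cut -[k.+1%:R]natr1 mulrDl mul1r.
  have : 0 < N.+1%:R^-1 :> R by rewrite invr_gt0 ltr0Sn.
  move: (N.+1%:R^-1) (k%:R / N.+1%:R) (p.1) => y x z y0.
  by case: (ltP z (x + y)) => ?; case: (ltP z x) => ?; apply/andP; split; lra.
exists (fun p => \sum_(k < N.+1) residue (dth k p)).
  have cdth k : continuous (residue \o dth k).
    apply: residue_continuous => //.
    have cc j : circular (fun p : R * R => th (cut j p.1) p.2).
      apply: (@circular_comp _ _ _
        (fun p : R * R => (clamp (cut j p.1), clamp p.2))) => //.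
      apply: pair_continuous; apply: comp_continuous clamp_continuous;
        last exact: snd_continuous.
      move=> p; apply: (@continuous_min _ _ (fst : R * R -> R) (fun=> j%:R / N.+1%:R)).
        exact: fst_continuous.
      exact: cst_continuous.
    exact: circularB.
  move=> p; have -> : (fun p => \sum_(k < N.+1) residue (dth k p)) =
      \sum_(k < N.+1) (residue \o dth k).
    by apply/funext => q; rewrite fct_sumE.
  elim/big_ind: _ => [|f g cf cg|k _]; [exact: cst_continuous|exact: cvgD|exact: cdth].
move=> s t; split.
  apply: big1 => k _; rewrite /dth /cut /= !(min_idPl _) ?divr_ge0 //.
  by rewrite subrr residue0.
have -> : theta (s, t) - theta (I0 R, t) =
    \sum_(k < N.+1) dth k (i01val s, i01val t).
  pose f k := th (cut k (i01val s)) (i01val t).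
  rewrite -(big_mkord xpredT (fun k => f k.+1 - f k)) telescope_sumr //.
  rewrite /f /th /cut clampK divff ?pnatr_eq0 // mul0r.
  have /andP[s0 s1] := i01val_itv s.
  by rewrite (min_idPl s1) (min_idPr s0) clampK clamp0.
by rewrite -sumrB; apply: rpred_sum => k _; exact: residue_int.
Qed.

(** * Winding of paths in the circle *)

Definition lifts (a theta : I01 R -> R) : Prop :=
  continuous a /\ forall t, a t - theta t \is a Num.int.

(** The formula is that of [turning], with an arbitrary circular function in place
of the angle on the rose. *)
Definition wind (theta : I01 R -> R) : R :=
  xget 0 [set d | exists a : I01 R -> R,
    [/\ continuous a, forall t, a t - theta t \is a Num.int &
        d = a (I1 R) - a (I0 R)]].

Lemma wind_lift (a theta : I01 R -> R) :
  lifts a theta -> wind theta = a (I1 R) - a (I0 R).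
Proof.
move=> [ca aint]; rewrite /wind.
case: xgetP => [d _ [b [cb bint ->]]|/(_ (a (I1 R) - a (I0 R)))]; last first.
  by case; exists a.
have : (a \o clamp) 0 - (b \o clamp) 0 = (a \o clamp) 1 - (b \o clamp) 1; last first.
  by rewrite /= clamp0 clamp1 => e; lra.
apply: (@int_continuous_const (fun x => (a \o clamp) x - (b \o clamp) x)).
  move=> x; apply: cvgB; apply: continuous_comp;
    (exact: clamp_continuous || exact: ca || exact: cb).
move=> t /=; rewrite clampK.
have -> : a t - b t = (a t - theta t) - (b t - theta t) by ring.
exact: rpredB.
Qed.

Lemma lift_of_sweep (theta : I01 R * I01 R -> R) (A : R * R -> R) (t : I01 R) :
  continuous A ->
  (forall s t, A (i01val s, i01val t) - (theta (s, t) - theta (I0 R, t)) \is a Num.int) ->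
  lifts (fun s => A (i01val s, i01val t) + theta (I0 R, t)) (fun s => theta (s, t)).
Proof.
move=> cA HA; split.
  have cl : continuous (fun s : I01 R => A (i01val s, i01val t)).
    apply: (@comp_continuous _ _ _ (fun s => (i01val s, i01val t)) A) => //.
    apply: pair_continuous; first exact: i01val_continuous.
    exact: cst_continuous.
  by move=> s; apply: continuousD; [exact: cl|exact: cst_continuous].
move=> s; have := HA s t.
rewrite (_ : _ - (_ - _) =
  A (i01val s, i01val t) + theta (I0 R, t) - theta (s, t)) //.
by ring.
Qed.

Lemma lift_exists (theta : I01 R -> R) :
  circular theta -> exists a, lifts a theta.
Proof.
move=> cth.
have [A cA HA] := @sweep (theta \o fst) (circular_comp (@fst_continuous _ _) cth).
by eexists; apply: (@lift_of_sweep (theta \o fst) A (I0 R)) => // s t; have [] := HA s t.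
Qed.

(** For a family of closed paths the swept change over the whole width is a
continuous integer-valued function of the parameter, hence constant. *)
Lemma wind_homotopy (theta : I01 R * I01 R -> R) : circular theta ->
  (forall t, theta (I1 R, t) - theta (I0 R, t) \is a Num.int) ->
  wind (fun s => theta (s, I0 R)) = wind (fun s => theta (s, I1 R)).
Proof.
move=> cth loop; have [A cA HA] := sweep cth.
have W t : wind (fun s => theta (s, t)) = A (1, i01val t).
  rewrite (wind_lift (lift_of_sweep t cA (fun s t => (HA s t).2))) /=.
  by rewrite opprD addrACA subrr addr0 (HA (I0 R) t).1 subr0.
rewrite !W /=; apply: (@int_continuous_const (fun t => A (1, t))).
  apply: (@comp_continuous _ _ _ (fun t : R => (1 : R, t)) A) => //.
  by apply: pair_continuous; [exact: cst_continuous|move=> t; exact: cvg_id].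
move=> t; have := rpredD (HA (I1 R) t).2 (loop t).
by rewrite subrK.
Qed.

End Lifting.

(** * Winding of closed paths in a graph *)

Section GraphWinding.
Variables (R : realType) (G : graph).

Local Notation cells := {e : 'I_(nE G) & I01 R}.
Local Notation X := (realization R G).

Definition eangle (e : 'I_(nE G)) (x : cells) : R :=
  let: existT e' t := x in if e' == e then i01val t else 0.

(** Coordinate along the edge [e], the other edges being collapsed to a point.
At a vertex the value is 0 or 1 according to the representative, so that only
the class modulo 1 is meaningful. *)
Definition edge_angle (e : 'I_(nE G)) (y : X) : R := eangle e (repr y).

Lemma repr_on_edge (e : 'I_(nE G)) (t : I01 R) :
  repr (on_edge e t) = existT _ e t \/
  end_vertex (repr (on_edge e t)) = end_vertex (existT (fun=> I01 R) e t) /\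
  end_vertex (existT (fun=> I01 R) e t).
Proof.
have /predU1P[->|/andP[h /eqP h']] : glued (repr (on_edge e t)) (existT _ e t).
  by apply/eqmodP; rewrite reprK.
  by left.
by right; split; rewrite -?h'.
Qed.

Lemma glue_pi (x y : cells) : end_vertex x -> end_vertex x = end_vertex y ->
  \pi_X x = \pi_X y.
Proof. by move=> h h'; apply/eqmodP; rewrite /= /glued h h' eqxx orbT. Qed.

Lemma on_edge_surj (x : X) : exists e t, x = on_edge e t.
Proof. by rewrite -[x]reprK; case: (repr x) => e t; exists e, t. Qed.

Lemma on_edge_continuous (e : 'I_(nE G)) : continuous (@on_edge R G e).
Proof.
apply: (@comp_continuous _ cells _ (existT (fun=> I01 R) e) \pi_X).
  exact: (@existT_continuous _ (fun=> I01 R) e).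
exact: pi_continuous.
Qed.

Lemma i01val0 : i01val (I0 R) = 0. Proof. by []. Qed.
Lemma i01val1 : i01val (I1 R) = 1. Proof. by []. Qed.

Lemma I1_neq0 : (I1 R == I0 R) = false.
Proof. by apply/eqP => /(congr1 (@i01val R)) /eqP; rewrite /i01val /= oner_eq0. Qed.

Lemma end_vertex0 (e : 'I_(nE G)) :
  end_vertex (existT (fun=> I01 R) e (I0 R)) = Some (src e).
Proof. by rewrite /= eqxx. Qed.

Lemma end_vertex1 (e : 'I_(nE G)) :
  end_vertex (existT (fun=> I01 R) e (I1 R)) = Some (tgt e).
Proof. by rewrite /= I1_neq0 eqxx. Qed.

Lemma end_vertexP (e : 'I_(nE G)) (t : I01 R) :
  end_vertex (existT (fun=> I01 R) e t) ->
  t = I0 R /\ end_vertex (existT (fun=> I01 R) e t) = Some (src e) \/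
  t = I1 R /\ end_vertex (existT (fun=> I01 R) e t) = Some (tgt e).
Proof.
rewrite /=; case: eqP => [->|_]; first by left.
by case: eqP => [->|//] _; right.
Qed.

Lemma continuous_repr (Z : topologicalType) (g : cells -> Z) :
  (forall e, continuous (fun t => g (existT (fun=> I01 R) e t))) ->
  (forall x y, end_vertex x -> end_vertex x = end_vertex y -> g x = g y) ->
  continuous (g \o repr : X -> Z).
Proof.
move=> cg gE; apply: repr_comp_continuous.
  move=> [e t] U nU; apply: (@existT_continuous _ (fun=> I01 R) e).
  exact: (cg e t U nU).
move=> x y /eqP/eqmodP/predU1P[->//|/andP[h /eqP h']].
by apply/eqP; exact: gE.
Qed.

Lemma eangle_int (e : 'I_(nE G)) (x : cells) : end_vertex x -> eangle e x \is a Num.int.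
Proof.
case: x => e' t /end_vertexP[] [-> _] /=; case: ifP => _; rewrite /i01val /=;
  by rewrite ?rpred0 ?rpred1.
Qed.

Lemma edge_angle_circular (e : 'I_(nE G)) : circular (edge_angle e).
Proof.
have C (u : R -> R) : continuous (u \o @i01val R) ->
    (forall x, x \is a Num.int -> u x = u 0) -> continuous (u \o edge_angle e).
  move=> cu u_int; apply: (@continuous_repr _ (u \o eangle e)) => [e'|x y xe xy] /=.
    by case: (e' == e) => //=; exact: cst_continuous.
  by rewrite !(u_int (eangle _ _)) // eangle_int // -?xy.
have [cc cs] := continuous_circular (@i01val_continuous R).
have [c0 s0] := ccos_csin_int (rpred0 _ : (0 : R) \is a Num.int).
by split; apply: C => // x /ccos_csin_int[c s]; congruence.
Qed.

Lemma edge_angle_on_edge (e e' : 'I_(nE G)) (t : I01 R) :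
  edge_angle e (on_edge e' t) - (if e' == e then i01val t else 0) \is a Num.int.
Proof.
rewrite /edge_angle; have [->|[h h']] := repr_on_edge e' t; first by rewrite subrr rpred0.
apply: rpredB; first by apply: eangle_int; rewrite h.
exact: (@eangle_int e (existT _ e' t)).
Qed.

Lemma glue_function (f : 'I_(nV G) -> R) (g : 'I_(nE G) -> I01 R -> R) :
  (forall e, continuous (g e)) ->
  (forall e, g e (I0 R) = f (src e)) -> (forall e, g e (I1 R) = f (tgt e)) ->
  exists2 F : X -> R, continuous F & forall e t, F (on_edge e t) = g e t.
Proof.
move=> cg g0 g1; pose gc (x : cells) := let: existT e t := x in g e t.
have H z v : end_vertex z = Some v -> gc z = f v.
  case: z => e t ev; have h : end_vertex (existT (fun=> I01 R) e t) by rewrite ev.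
  by case: (end_vertexP h) => -[te]; rewrite ev => -[->]; rewrite /gc te.
have gcE x y : end_vertex x -> end_vertex x = end_vertex y -> gc x = gc y.
  by case E: (end_vertex x) => [v|] // _ /esym /H ->; exact: H.
exists (gc \o repr); first exact: continuous_repr.
move=> e t; have [|[h h']] := repr_on_edge e t; first by move=> /= ->.
by rewrite /= (gcE _ _ _ h) // h.
Qed.

(** If theta differs from an integral combination of the edge angles by a real
function on the graph, that function does not contribute on closed paths. *)
Lemma wind_decomp (theta F : X -> R) (m : 'I_(nE G) -> R) (delta : I01 R -> X) :
  continuous delta -> delta (I0 R) = delta (I1 R) ->
  continuous F -> (forall e, m e \is a Num.int) ->
  (forall x, F x + \sum_e m e * edge_angle e x - theta x \is a Num.int) ->
  wind (theta \o delta) = \sum_e m e * wind (edge_angle e \o delta).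
Proof.
move=> cd loop cF mint HF.
have /choice[a Ha] : forall e, exists a, lifts a (edge_angle e \o delta).
  by move=> e; apply: lift_exists; apply: circular_comp => //; exact: edge_angle_circular.
rewrite (@wind_lift _ (fun t => F (delta t) + \sum_e m e * a e t)); last first.
  split.
    have cS : continuous (fun t => \sum_e m e * a e t).
      rewrite (_ : (fun t => _) = \sum_e (fun t => m e * a e t)); last first.
        by apply/funext => s; rewrite fct_sumE.
      elim/big_ind: _ => [|f g cf cg|e _] t;
        [exact: cst_continuous|exact: (continuousD (cf t) (cg t))|].
      by apply: continuousM; [exact: cst_continuous|exact: (Ha e).1].
    by move=> t; apply: continuousD; [exact: (comp_continuous cd cF)|exact: cS].
  move=> t; have := HF (delta t).
  have S : \sum_e m e * (a e t - edge_angle e (delta t)) \is a Num.int.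
    by apply: rpred_sum => e _; apply: rpredM => //; exact: (Ha e).2.
  move=> /(rpredD S); congr (_ \is a Num.int).
  under eq_bigr do rewrite mulrBr.
  by rewrite sumrB /=; ring.
rewrite loop opprD addrACA subrr add0r -sumrB.
by apply: eq_bigr => e _; rewrite (wind_lift (Ha e)) mulrBr.
Qed.

Lemma wind_edge_angle_int (delta : I01 R -> X) (e : 'I_(nE G)) :
  continuous delta -> delta (I0 R) = delta (I1 R) ->
  wind (edge_angle e \o delta) \is a Num.int.
Proof.
move=> cd loop.
have [a Ha] : exists a, lifts a (edge_angle e \o delta).
  by apply: lift_exists; apply: circular_comp => //; exact: edge_angle_circular.
rewrite (wind_lift Ha); have := rpredB (Ha.2 (I1 R)) (Ha.2 (I0 R)).
by congr (_ \is a Num.int); rewrite /= loop; ring.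
Qed.

(** The windings of a closed path along the edges form a cycle: the tent
function equal to 1 at a vertex v is, modulo integers, the sum of the angles of
the edges entering v minus that of the edges leaving v. *)
Lemma wind_boundary (delta : I01 R -> X) (v : 'I_(nV G)) :
  continuous delta -> delta (I0 R) = delta (I1 R) ->
  \sum_(e | tgt e == v) wind (edge_angle e \o delta)
    = \sum_(e | src e == v) wind (edge_angle e \o delta).
Proof.
move=> cd loop.
pose f (u : 'I_(nV G)) : R := (u == v)%:R.
have fint u : f u \is a Num.int by rewrite /f natr_int.
pose g e (t : I01 R) := f (src e) + (f (tgt e) - f (src e)) * i01val t.
have [||F|F cF HF] := @glue_function f g.
- move=> e; apply: (@addr_continuous _ _ (fun=> _) (fun t => _ * i01val t)).
    exact: cst_continuous.
  by apply: mull_continuous; exact: i01val_continuous.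
- by move=> e; rewrite /g i01val0 mulr0 addr0.
- by rewrite /g i01val1 mulr1 addrC subrK.
have wind0 : wind ((fun=> 0 : R) \o delta) = 0.
  rewrite (@wind_lift _ (fun=> 0)) ?subrr //; split; first exact: cst_continuous.
  by move=> t; rewrite subrr rpred0.
have := @wind_decomp (fun=> 0) F (fun e => f (src e) - f (tgt e)) delta cd loop cF.
rewrite wind0 => /(_ _ _)/esym H; apply/eqP; rewrite -subr_eq0 -oppr_eq0 opprB; apply/eqP.
rewrite -{}[RHS]H; last 2 first.
- by move=> e; exact: rpredB.
- move=> x; have [e [t ->]] := on_edge_surj x; rewrite HF subr0.
  have -> : g e t = f (src e) +
      \sum_e' (f (tgt e') - f (src e')) * (if e == e' then i01val t else 0).
    congr (_ + _); rewrite (bigD1 e) //= eqxx big1 ?addr0 // => e' /negPf.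
    by rewrite eq_sym => ->; rewrite mulr0.
  rewrite -addrA -big_split /=; apply: rpredD => //; apply: rpred_sum => e' _.
  have E (a b c d : R) : (a - b) * c + (b - a) * d = (b - a) * (d - c) by ring.
  by rewrite E; apply: rpredM; [exact: rpredB|exact: edge_angle_on_edge].
rewrite big_mkcond [X in _ - X]big_mkcond -sumrB; apply: eq_bigr => e _.
by rewrite /f; case: (src e == v); case: (tgt e == v) => /=; ring.
Qed.

(** Up to a real function on the graph, a circular function is linear with
integral slopes on the edges; real functions do not contribute on closed paths,
and their contributions to the edges cancel along a cycle. *)
Theorem wind_loop (theta : X -> R) (delta : I01 R -> X) :
  circular theta -> continuous delta -> delta (I0 R) = delta (I1 R) ->
  wind (theta \o delta) =
    \sum_e wind (edge_angle e \o delta) * wind (theta \o @on_edge R G e).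
Proof.
move=> cth cd loop.
pose f v := xget 0
  [set r | exists2 x : cells, end_vertex x = Some v & r = theta (\pi_X x)].
have fE x v : end_vertex x = Some v -> theta (\pi_X x) = f v.
  move=> xv; rewrite /f; case: xgetP => [r _ [y yv ->]|/(_ (theta (\pi_X x)))];
    last by case; exists x.
  by rewrite (@glue_pi x y) // xv.
have /choice[a Ha] : forall e, exists a, lifts a (theta \o @on_edge R G e).
  by move=> e; apply: lift_exists; apply: circular_comp => //; exact: on_edge_continuous.
have a0 e : a e (I0 R) - f (src e) \is a Num.int.
  by rewrite -(fE _ _ (end_vertex0 e)); exact: (Ha e).2.
have a1 e : a e (I1 R) - f (tgt e) \is a Num.int.
  by rewrite -(fE _ _ (end_vertex1 e)); exact: (Ha e).2.
pose m e := a e (I1 R) - a e (I0 R) - (f (tgt e) - f (src e)).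
have mint e : m e \is a Num.int.
  by have := rpredB (a1 e) (a0 e); congr (_ \is a Num.int); rewrite /m; ring.
pose g e t := a e t - (a e (I0 R) - f (src e)) + (- m e) * i01val t.
have [||F|F cF HF] := @glue_function f g.
- move=> e; apply: (@addr_continuous _ _ (fun t => a e t - _) (fun t => _ * i01val t)).
    apply: (@addr_continuous _ _ (a e) (fun=> _)); first exact: (Ha e).1.
    exact: cst_continuous.
  by apply: mull_continuous; exact: i01val_continuous.
- by move=> e; rewrite /g i01val0; ring.
- by rewrite /g /m i01val1; ring.
rewrite (@wind_decomp theta F m delta) //; last first.
  move=> x; have [e [t ->]] := on_edge_surj x; rewrite HF.
  have S : \sum_e' m e' * (edge_angle e' (on_edge e t) -
      (if e == e' then i01val t else 0)) \is a Num.int.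
    by apply: rpred_sum => e' _; apply: rpredM => //; exact: edge_angle_on_edge.
  have := rpredD S (rpredB ((Ha e).2 t) (a0 e)); congr (_ \is a Num.int).
  under eq_bigr do rewrite mulrBr.
  rewrite sumrB /=.
  have -> : \sum_e' m e' * (if e == e' then i01val t else 0) = m e * i01val t.
    rewrite (bigD1 e) //= eqxx big1 ?addr0 // => e' /negPf.
    by rewrite eq_sym => ->; rewrite mulr0.
  by rewrite /g; ring.
pose w e := wind (edge_angle e \o delta).
have telescope : \sum_e w e * (f (tgt e) - f (src e)) = 0.
  under eq_bigr do rewrite mulrBr.
  rewrite sumrB (partition_big (@tgt G) xpredT) //=.
  rewrite [X in _ - X](partition_big (@src G) xpredT) //= -sumrB big1 // => v _.
  rewrite (eq_bigr (fun e => w e * f v)); last by move=> e /eqP ->.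
  rewrite [X in _ - X](eq_bigr (fun e => w e * f v)); last by move=> e /eqP ->.
  by rewrite -!mulr_suml wind_boundary // subrr.
rewrite -[RHS]subr0 -[X in _ = _ - X]telescope -sumrB; apply: eq_bigr => e _.
by rewrite (wind_lift (Ha e)) /m /w; ring.
Qed.

End GraphWinding.

(** * The action of a marking on homology *)

Section Markings.
Variable R : realType.

Lemma wind_homotopic (X Y : topologicalType) (k k' : X -> Y) (theta : Y -> R)
    (delta : I01 R -> X) :
  homotopic R k k' -> circular theta ->
  continuous delta -> delta (I0 R) = delta (I1 R) ->
  wind (theta \o k \o delta) = wind (theta \o k' \o delta).
Proof.
move=> [H cH HE] cth cd loop.
have c2 : circular (fun st : I01 R * I01 R => theta (H (delta st.1, st.2))).
  apply: (@circular_comp _ _ _ (fun st : I01 R * I01 R => H (delta st.1, st.2))) => //.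
  apply: (@comp_continuous _ _ _ (fun st : I01 R * I01 R => (delta st.1, st.2))) => //.
  apply: pair_continuous; last exact: snd_continuous.
  by apply: (@comp_continuous _ _ _ fst) => //; exact: fst_continuous.
have := wind_homotopy c2; rewrite /= => W.
rewrite (_ : theta \o k \o delta = (fun s => theta (H (delta s, I0 R)))); last first.
  by apply/funext => s /=; rewrite (HE _).1.
rewrite W; last by move=> t; rewrite loop subrr rpred0.
by congr wind; apply/funext => s /=; rewrite (HE _).2.
Qed.

Lemma wind_on_edge (G : graph) (e e' : 'I_(nE G)) :
  wind (edge_angle e \o @on_edge R G e') = (e' == e)%:R.
Proof.
rewrite (@wind_lift _ (fun t => (e' == e)%:R * i01val t)).
  by rewrite i01val0 i01val1; ring.
split; first by apply: mull_continuous; exact: i01val_continuous.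
move=> t; rewrite -opprB rpredN; have := edge_angle_on_edge e e' t.
by case: (e' == e); rewrite ?mul1r ?mul0r.
Qed.

Lemma on_edge_loop (G : graph) (e : 'I_(nE G)) : src e = tgt e ->
  @on_edge R G e (I0 R) = on_edge e (I1 R).
Proof. by move=> st; apply: glue_pi; rewrite end_vertex0 // end_vertex1 st. Qed.

Lemma turningE n (i : 'I_n) (gamma : I01 R -> realization R (rose n)) :
  turning i gamma = wind (@edge_angle R (rose n) i \o gamma).
Proof. by []. Qed.

(** Surjectivity of h on integral homology: push a circle of the rose back to
G by a homotopy inverse and read off its windings along the edges of G. *)
Lemma marking_cycle n (G : graph) (h : realization R G -> realization R (rose n))
    (i : 'I_n) : marking h ->
  exists c, cycles c /\ h_push h c = delta_mx 0 i.
Proof.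
move=> [ch [g [cg _ hg]]].
pose delta := g \o @on_edge R (rose n) i.
have cgamma := @on_edge_continuous R (rose n) i.
have cdelta : continuous delta by exact: (comp_continuous cgamma cg).
have gloop : @on_edge R (rose n) i (I0 R) = @on_edge R (rose n) i (I1 R).
  exact: on_edge_loop.
have loop : delta (I0 R) = delta (I1 R) by rewrite /delta /= gloop.
have /choice[c Hc] e : exists m : int, wind (edge_angle e \o delta) = m%:~R.
  by apply/intrP; exact: wind_edge_angle_int.
exists (\row_e c e); split.
  move=> v; have := wind_boundary v cdelta loop.
  under eq_bigr do rewrite Hc; under [in RHS]eq_bigr do rewrite Hc.
  rewrite -!rmorph_sum /= => /eqP; rewrite eqr_int => /eqP E.
  by under eq_bigr do rewrite mxE; under [in RHS]eq_bigr do rewrite mxE.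
apply/rowP => j; rewrite !mxE eqxx /=.
have ca : circular (@edge_angle R (rose n) j) by exact: edge_angle_circular.
have := wind_loop (circular_comp ch ca) cdelta loop.
have -> : (@edge_angle R (rose n) j \o h) \o delta =
  @edge_angle R (rose n) j \o (h \o g) \o @on_edge R (rose n) i by [].
rewrite (wind_homotopic hg ca cgamma gloop) => E.
transitivity (wind (@edge_angle R (rose n) j \o @on_edge R (rose n) i)); last first.
  by rewrite wind_on_edge eq_sym.
by rewrite [RHS]E; apply: eq_bigr => e _; rewrite mxE Hc turningE.
Qed.

Lemma basis_cycleP n (G : graph) (h : realization R G -> realization R (rose n))
    (i : 'I_n) : marking h ->
  cycles (basis_cycle h i) /\ h_push h (basis_cycle h i) = delta_mx 0 i.
Proof.
move=> mh; rewrite /basis_cycle; case: xgetP => [//|H].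
by have [c Hc] := marking_cycle i mh; case: (H c).
Qed.

(** With a single vertex every edge is a closed path, and a homotopy inverse of h
factors the identity matrix of size nE G through dimension n. *)
Lemma marked_rose_edges n (G : graph) (h : realization R G -> realization R (rose n)) :
  marking h -> nV G = 1%N -> (nE G <= n)%N.
Proof.
move=> [ch [g [cg gh _]]] V1.
have st (e : 'I_(nE G)) : src e = tgt e.
  by apply/val_inj; move: (src e) (tgt e); rewrite V1 => u v; rewrite !ord1.
pose M : 'M[R]_(nE G, n) := \matrix_(e, j)
  wind (@edge_angle R (rose n) j \o (h \o on_edge e)).
pose N : 'M[R]_(n, nE G) := \matrix_(j, e')
  wind ((edge_angle e' \o g) \o @on_edge R (rose n) j).
have MN : M *m N = 1%:M.
  apply/matrixP => e e'; rewrite !mxE.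
  have ca := @edge_angle_circular R G e'.
  have ce := @on_edge_continuous R G e.
  have loop := on_edge_loop (st e).
  rewrite -(wind_on_edge e' e).
  transitivity (wind (edge_angle e' \o (g \o h) \o on_edge e)); last first.
    exact: (wind_homotopic gh ca ce loop).
  have := wind_loop (circular_comp cg ca) (comp_continuous ce ch) (congr1 h loop).
  by move=> E; apply: (etrans _ (esym E)); apply: eq_bigr => j _; rewrite !mxE.
have := mxrankM_maxl M N; rewrite MN mxrank1 => /leq_trans; apply.
exact: rank_leq_col.
Qed.

End Markings.

(** * Homotopies and orbits of simplices *)

Section HomotopyCalculus.
Variable R : realType.
Implicit Types X Y Z : topologicalType.

Lemma homotopic_refl X Y (f : X -> Y) : continuous f -> homotopic R f f.
Proof.
move=> cf; exists (f \o fst) => //.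
by apply: comp_continuous => //; exact: fst_continuous.
Qed.

Lemma reparam_continuous X Y (H : X * I01 R -> Y) (r : R -> R) :
  continuous H -> continuous r ->
  continuous (fun xt => H (xt.1, clamp (r (i01val xt.2)))).
Proof.
move=> cH cr.
apply: (@comp_continuous _ _ _
  (fun xt : X * I01 R => (xt.1, clamp (r (i01val xt.2))))) => //.
apply: pair_continuous; first exact: fst_continuous.
apply: (@comp_continuous _ _ _ (fun xt : X * I01 R => r (i01val xt.2)));
  last exact: clamp_continuous.
apply: (@comp_continuous _ _ _ (fun xt : X * I01 R => i01val xt.2)) => //.
exact: (comp_continuous (@snd_continuous _ _) (@i01val_continuous R)).
Qed.

Lemma homotopic_sym X Y (f g : X -> Y) : homotopic R f g -> homotopic R g f.
Proof.
move=> [H cH HE]; exists (fun xt => H (xt.1, clamp (1 - i01val xt.2))).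
  apply: (reparam_continuous cH (r := fun t => 1 - t)) => t.
  by apply: cvgB; [exact: cvg_cst|exact: cvg_id].
by move=> x /=; rewrite i01val0 i01val1 subr0 subrr clamp0 clamp1; have [] := HE x.
Qed.

Lemma homotopic_trans X Y (f g k : X -> Y) :
  homotopic R f g -> homotopic R g k -> homotopic R f k.
Proof.
move=> [H cH HE] [K cK KE].
pose A := [set xt : X * I01 R | i01val xt.2 <= 2^-1].
pose B := [set xt : X * I01 R | 2^-1 <= i01val xt.2].
pose H' (xt : X * I01 R) := H (xt.1, clamp (2 * i01val xt.2)).
pose K' (xt : X * I01 R) := K (xt.1, clamp (2 * i01val xt.2 - 1)).
pose L xt := if i01val xt.2 <= 2^-1 then H' xt else K' xt.
have c2 : continuous (fun xt : X * I01 R => i01val xt.2).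
  by apply: (comp_continuous (@snd_continuous _ _)); exact: i01val_continuous.
have cH' : continuous H'.
  apply: (reparam_continuous cH (r := fun t => 2 * t)) => t.
  by apply: cvgM; [exact: cvg_cst|exact: cvg_id].
have cK' : continuous K'.
  apply: (reparam_continuous cK (r := fun t => 2 * t - 1)) => t.
  apply: cvgB; last exact: cvg_cst.
  by apply: cvgM; [exact: cvg_cst|exact: cvg_id].
have cA : closed A.
  apply: (@closed_comp _ _ (fun xt : X * I01 R => i01val xt.2)
    [set y | y <= 2^-1]) => [x _|]; [exact: c2|exact: closed_le].
have cB : closed B.
  apply: (@closed_comp _ _ (fun xt : X * I01 R => i01val xt.2)
    [set y | 2^-1 <= y]) => [x _|]; [exact: c2|exact: closed_ge].
have cL : continuous L.
  apply/continuous_subspace_setT.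
  have -> : [set: X * I01 R] = A `|` B.
    apply/seteqP; split=> // xt _; rewrite /A /B /=.
    by case: (lerP (i01val xt.2) 2^-1) => [|/ltW]; [left|right].
  apply: withinU_continuous => //.
    apply: (@subspace_eq_continuous _ _ _ H').
      by move=> xt /set_mem h; rewrite /from_subspace /L ifT.
    exact: continuous_subspaceT.
  apply: (@subspace_eq_continuous _ _ _ K').
    move=> xt /set_mem h; rewrite /from_subspace /L; case: ifPn => // h'.
    have e : i01val xt.2 = 2^-1 by apply/eqP; rewrite eq_le h' h.
    rewrite /H' /K' e divff // subrr.
    by rewrite clamp1 clamp0 (HE _).2 (KE _).1.
  exact: continuous_subspaceT.
exists L => // x; rewrite /L /H' /K' /= i01val0 i01val1.
rewrite invr_ge0 ler0n mulr0 clamp0 (HE _).1; split=> //.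
case: ifPn => [h|_]; first by exfalso; lra.
by rewrite (_ : 2 * 1 - 1 = 1 :> R) ?clamp1 ?(KE _).2 //; ring.
Qed.

Lemma homotopic_postcomp X Y Z (k : Y -> Z) (f g : X -> Y) :
  continuous k -> homotopic R f g -> homotopic R (k \o f) (k \o g).
Proof.
move=> ck [H cH HE]; exists (k \o H); first exact: comp_continuous.
by move=> x /=; rewrite (HE x).1 (HE x).2.
Qed.

Lemma homotopic_precomp X Y Z (k : X -> Y) (f g : Y -> Z) :
  continuous k -> homotopic R f g -> homotopic R (f \o k) (g \o k).
Proof.
move=> ck [H cH HE]; exists (fun xt => H (k xt.1, xt.2)) => [|x]; last exact: HE.
apply: (@comp_continuous _ _ _ (fun xt : X * I01 R => (k xt.1, xt.2))) => //.
apply: pair_continuous; last exact: snd_continuous.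
by apply: (comp_continuous (@fst_continuous _ _)).
Qed.

Lemma homotopy_equivalence_comp X Y Z (f : X -> Y) (g : Y -> Z) :
  homotopy_equivalence R f -> homotopy_equivalence R g ->
  homotopy_equivalence R (g \o f).
Proof.
move=> [cf [f' [cf' ff' f'f]]] [cg [g' [cg' gg' g'g]]].
split; first exact: comp_continuous.
exists (f' \o g'); split; first exact: comp_continuous.
- apply: homotopic_trans ff'.
  exact: (homotopic_postcomp cf' (homotopic_precomp cf gg')).
- apply: homotopic_trans g'g.
  exact: (homotopic_postcomp cg (homotopic_precomp cg' f'f)).
Qed.

(** For two markings of the same graph, phi is the element of Out(F_n) that carries
the first one to the second. *)
Lemma homotopy_equivalence_quotient X Y Z (h : X -> Y) (k : X -> Z) :
  homotopy_equivalence R h -> homotopy_equivalence R k ->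
  exists2 phi : Y -> Z, homotopy_equivalence R phi & homotopic R (phi \o h) k.
Proof.
move=> [ch [g [cg gh hg]]] hk; exists (k \o g).
  apply: homotopy_equivalence_comp hk; split=> //; exists h; split=> //.
exact: (homotopic_postcomp hk.1 gh).
Qed.

End HomotopyCalculus.

Section Orbits.
Variables (R : realType) (n : nat).
Local Notation Rn := (realization R (rose n)).
Implicit Types m : metric_triple R n.

Lemma equivalent_refl m : marked_metric_graph m -> equivalent m m.
Proof.
move=> [[_ [ch _]] _]; exists idfun; last exact: homotopic_refl.
split; first by move=> x; exact: cvg_id.
by split=> //; exists idfun; split=> // x; exact: cvg_id.
Qed.

Lemma equivalent_sym m m' :
  marked_metric_graph m' -> equivalent m m' -> equivalent m' m.
Proof.
move=> [[_ [ch' _]] _] [f [cf [[g [cg fg gf]] df]] Hf].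
exists g.
  split=> //; split; first by exists f.
  by move=> x y; rewrite -df !gf.
have := homotopic_sym (homotopic_precomp cg Hf).
by rewrite (_ : (_ \o f) \o g = @mt_map _ _ m') //; apply/funext => x /=; rewrite gf.
Qed.

Lemma equivalent_trans m m' m'' :
  equivalent m m' -> equivalent m' m'' -> equivalent m m''.
Proof.
move=> [f [cf [[g [cg fg gf]] df]] Hf] [f' [cf' [[g' [cg' fg' gf']] df']] Hf'].
exists (f' \o f).
  split; first exact: comp_continuous.
  split; last by move=> x y /=; rewrite df' df.
  exists (g \o g'); split; first exact: comp_continuous.
  - by move=> x /=; rewrite fg' fg.
  - by move=> x /=; rewrite gf gf'.
exact: homotopic_trans (homotopic_precomp cf Hf') Hf.
Qed.

Lemma outer_point_eq m m' : marked_metric_graph m' ->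
  equivalent m m' -> outer_point m = outer_point m'.
Proof.
move=> mm' e; apply/seteqP; split=> x [mx ex]; split=> //.
  exact: equivalent_trans (equivalent_sym mm' e) ex.
exact: equivalent_trans e ex.
Qed.

Lemma act_marked phi m : self_equivalences phi ->
  marked_metric_graph m -> marked_metric_graph (act phi m).
Proof.
by move=> sphi [[aG mh] ol]; split=> //; split=> //; exact: homotopy_equivalence_comp.
Qed.

Lemma act_equivalent phi m m' : self_equivalences phi ->
  equivalent m m' -> equivalent (act phi m) (act phi m').
Proof.
by move=> [cphi _] [f isof Hf]; exists f => //; exact: homotopic_postcomp Hf.
Qed.

Lemma out_act_point phi m : self_equivalences phi -> marked_metric_graph m ->
  out_act phi (outer_point m) = outer_point (act phi m).
Proof.
move=> sphi mm; apply/seteqP; split.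
  move=> x [m' [mm' em'] xm'].
  rewrite (@outer_point_eq _ (act phi m')) //; first exact: act_marked.
  exact: act_equivalent.
by move=> x hx; exists m => //; split=> //; exact: equivalent_refl.
Qed.

Lemma simplex_act (G : graph) (h : realization R G -> Rn) (phi : Rn -> Rn) :
  self_equivalences phi -> marked_graph h ->
  [set out_act phi p | p in simplex h] = simplex (phi \o h).
Proof.
move=> sphi mh; rewrite /simplex image_comp; apply: eq_imagel => l ol /=.
by rewrite out_act_point.
Qed.

Lemma simplex_homotopic (G : graph) (h k : realization R G -> Rn) :
  marked_graph h -> homotopic R h k -> simplex h = simplex k.
Proof.
move=> mh hk; apply: eq_imagel => l ol; apply/esym/outer_point_eq => //.
exists idfun => //; split; first by move=> x; exact: cvg_id.
by split=> //; exists idfun; split=> // x; exact: cvg_id.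
Qed.

(** Out(F_n) permutes the markings of a given graph transitively: the left-hand
side depends on the graph only, which bounds the number of orbits. *)
Lemma simplex_orbitE (G : graph) (h : realization R G -> Rn) : marked_graph h ->
  simplex_orbit (simplex h) = [set simplex k | k in @marked_graph R n G].
Proof.
move=> mh; apply/seteqP; split=> [_ [phi sphi <-]|_ [k mk <-]].
  rewrite simplex_act //; exists (phi \o h) => //.
  by split; [exact: mh.1|exact: homotopy_equivalence_comp mh.2 sphi].
have [phi sphi Hphi] := homotopy_equivalence_quotient mh.2 mk.2.
exists phi => //; rewrite simplex_act //; apply: simplex_homotopic => //.
by split; [exact: mh.1|exact: homotopy_equivalence_comp mh.2 sphi].
Qed.

End Orbits.

(** * Marked graphs of rank 2 with three edges *)

Section ThetaGraph.
Variable G : graph.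

Lemma incidence_count (f : 'I_(nE G) -> 'I_(nV G)) :
  (\sum_v #|[set e | f e == v]%SET| = nE G)%N.
Proof.
under eq_bigr do rewrite -sum1dep_card big_mkcond /=.
rewrite exchange_big /= -[RHS]card_ord -sum1_card; apply: eq_bigr => e _.
by rewrite -big_mkcond /= (big_pred1 (f e)).
Qed.

Lemma sum_valence : (\sum_(v : 'I_(nV G)) valence v = 2 * nE G)%N.
Proof. by rewrite big_split /= !incidence_count mul2n addnn. Qed.

Lemma connect_nonloop (P : pred 'I_(nE G)) (u v : 'I_(nV G)) :
  fingraph.connect (adj P) u v -> u != v ->
  exists e, [/\ P e, src e != tgt e & (src e == u) || (tgt e == u)].
Proof.
move=> /connectP[p]; elim: p u => [|w p IH] u /=; first by move=> _ ->; rewrite eqxx.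
move=> /andP[uw pw] lv uv; have [e0 /andP[Pe euw]] := existsP uw.
have [uw0|nuw] := eqVneq u w; first by rewrite uw0 in uv *; exact: IH.
exists e0; split=> //.
  by case/orP: euw => /andP[/eqP -> /eqP ->] //; rewrite eq_sym.
by case/orP: euw => /andP[h1 h2]; rewrite ?h1 ?h2 ?orbT.
Qed.

Lemma valence_gt0 (u v : 'I_(nV G)) : graph_connected G -> u != v ->
  (0 < valence u)%N.
Proof.
move=> /andP[_ /forallP/(_ u)/forallP/(_ v) uv] nuv.
have [e [_ _ eu]] := connect_nonloop uv nuv; rewrite /valence addn_gt0.
apply/orP; case/orP: eu => eu; [left|right];
  by apply/card_gt0P; exists e; rewrite inE.
Qed.

(** Valences are at least 3 and add up to 6, which leaves two vertices. Were e0 a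
loop, some edge e1 would join the vertices, and another one, e2, as well, since
neither e0 nor e1 separates; the vertex not on e0 would have valence 2. *)
Lemma admissible_theta : admissible G -> nE G = 3%N -> nV G <> 1%N ->
  nV G = 2%N /\ forall e : 'I_(nE G), src e != tgt e.
Proof.
move=> [Gconn val12 nonsep] E3 V1; have /andP[V0 _] := Gconn.
pose v0 : 'I_(nV G) := Ordinal V0.
have V1' : (1 < nV G)%N by move: (V0) V1; lia.
pose v1 : 'I_(nV G) := Ordinal V1'.
have v01 : v0 != v1 by [].
have val3 (v : 'I_(nV G)) : (3 <= valence v)%N.
  have : (0 < valence v)%N.
    have [->|] := eqVneq v v0; first exact: (valence_gt0 Gconn v01).
    exact: valence_gt0.
  by have [] := val12 v; case: (valence v) => [|[|[]]].
have V2 : nV G = 2%N.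
  have : (\sum_(v : 'I_(nV G)) 3 <= \sum_(v : 'I_(nV G)) valence v)%N by exact: leq_sum.
  by rewrite sum_valence E3 sum_nat_const card_ord; lia.
split=> // e0; apply/negP => /eqP loop0.
have nonloop (e : 'I_(nE G)) : exists2 e', e' != e & src e' != tgt e'.
  have /negPn/forallP/(_ v0)/forallP/(_ v1) c := nonsep e.
  by have [e' [? ? _]] := connect_nonloop c v01; exists e'.
have [e1 e10 nl1] := nonloop e0; have [e2 e21 nl2] := nonloop e1.
have e20 : e2 != e0 by apply: contraNneq nl2 => ->; rewrite loop0.
pose w := if src e0 == v0 then v1 else v0.
have ordV (u : 'I_(nV G)) : (u = v0) \/ (u = v1).
  have : (u < 2)%N by rewrite -V2.
  by case E : (val u) => [|[]] // _; [left|right]; apply: val_inj.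
have only (e : 'I_(nE G)) : [\/ e = e0, e = e1 | e = e2].
  have [|n0] := eqVneq e e0; first by constructor 1.
  have [|n1] := eqVneq e e1; first by constructor 2.
  constructor 3; apply/val_inj/eqP.
  have lt3 (x : 'I_(nE G)) : (x < 3)%N by rewrite -E3.
  have := lt3 e; have := lt3 e0; have := lt3 e1; have := lt3 e2.
  move: n0 n1 e10 e21 e20; rewrite -!val_eqE /=; lia.
have w0 : src e0 != w by rewrite /w; case: ifP => [/eqP ->|/negbT].
have vw : valence w = 2%N.
  rewrite /valence -!sum1dep_card big_mkcond [X in (_ + X)%N]big_mkcond -big_split /=.
  rewrite (bigD1 e0) //= (bigD1 e1) //= (bigD1 e2) /=; last by rewrite e20 e21.
  rewrite big1 => [|e /andP[/andP[n0 n1] n2]]; last first.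
    by case: (only e) n0 n1 n2 => ->; rewrite eqxx.
  rewrite -loop0 (negPf w0) /= add0n.
  have nl (e : 'I_(nE G)) : src e != tgt e ->
      ((if src e == w then 1 else 0) + (if tgt e == w then 1 else 0) = 1)%N.
    by case: (ordV (src e)) => ->; case: (ordV (tgt e)) => ->; case: (ordV w) => ->;
      rewrite ?eqxx.
  by rewrite !nl.
by have [] := val12 w.
Qed.

End ThetaGraph.

(** * The period map on a theta graph *)

Section PeriodMetric.
Variable R : realType.

Lemma ord2P (k : 'I_2) : k = 0 \/ k = 1.
Proof. by case: k => [[|[]]] // p; [left|right]; apply: val_inj. Qed.

Lemma sum_ord3 (f : 'I_3 -> R) : \sum_e f e = f 0 + f 1 + f 2.
Proof.
rewrite !big_ord_recl big_ord0 addr0 addrA.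
by congr (_ + f _ + f _); apply: val_inj.
Qed.

Lemma det_mx2 (K : comRingType) (A : 'M[K]_2) :
  \det A = A 0 0 * A 1 1 - A 0 1 * A 1 0.
Proof.
rewrite (expand_det_row _ 0) !big_ord_recl big_ord0 /cofactor !det_mx11 !mxE /=.
have -> : lift 0 0 = 1 :> 'I_2 by apply: val_inj.
have -> : lift 1 0 = 0 :> 'I_2 by apply: val_inj.
rewrite /bump /=; ring.
Qed.

Lemma invmxE (K : comUnitRingType) n (A B : 'M[K]_n) : A *m B = 1%:M -> invmx A = B.
Proof.
by move=> AB; have [uA _] := mulmx1_unit AB; rewrite -[LHS]mulmx1 -AB mulKmx.
Qed.

(** The reason why the area does not depend on the marking, which enters only
through the change of basis P. *)
Lemma ds2_inv_congr n (P Y A B : 'M[R]_n) : P \in unitmx -> Y \in unitmx ->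
  ds2_inv (P *m Y *m P^T) (P *m A *m P^T) (P *m B *m P^T) = ds2_inv Y A B.
Proof.
move=> uP uY; have uPT : P^T \in unitmx by rewrite unitmx_tr.
have inv : invmx (P *m Y *m P^T) = invmx P^T *m invmx Y *m invmx P.
  by apply: invmxE; rewrite !mulmxA mulmxK // mulmxK // mulmxV.
rewrite /ds2_inv inv !mulmxA.
by rewrite mulmxKV // mulmxK // mxtrace_mulC !mulmxA mulmxV // mul1mx mulmxKV.
Qed.

Lemma period_affine n (G : graph) (h : realization R G -> realization R (rose n))
    (l u : 'rV[R]_(nE G)) (t : R) :
  period h (l + t *: u) = period h l + t *: period h u.
Proof.
apply/matrixP => i j; rewrite !mxE /length_form mulr_sumr -big_split /=.
by apply: eq_bigr => e _; rewrite !mxE; ring.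
Qed.

Lemma dperiodE n (G : graph) (h : realization R G -> realization R (rose n))
    (l u : 'rV[R]_(nE G)) : dperiod h l u = period h u.
Proof.
apply/matrixP => i j; rewrite mxE.
have -> : (fun t : R => period h (l + t *: u) i j) =
    (fun t : R => period h l i j + t * period h u i j).
  by apply/funext => t; rewrite period_affine !mxE.
move: (period h l i j) (period h u i j) => a b.
have -> : (fun t => a + t * b) = cst a + (b \*: @id R).
  by apply/funext => t /=; rewrite mulrC.
by rewrite derive1E derive_val add0r scaler1.
Qed.

(** The period matrix of a theta graph with edges of lengths x, y, z oriented from
one vertex to the other, in the basis e_0 - e_2, e_1 - e_2 of its cycles. *)
Definition theta_form (x y z : R) : 'M[R]_2 :=
  \matrix_(i, j) (z + if i == j then (if i == 0 then x else y) else 0).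

Lemma theta_form_inv (x y z : R) : x * y + y * z + z * x != 0 ->
  invmx (theta_form x y z) = (x * y + y * z + z * x)^-1 *:
    \matrix_(i, j) (- z +
      if i == j then (if i == 0 then y + z + z else x + z + z) else 0).
Proof.
move=> D0; apply: invmxE.
have := divff D0; set d := (_ + _ + _)^-1 => D1.
apply/matrixP => i j; rewrite !mxE !big_ord_recl big_ord0 !mxE.
by case: (ord2P i) => ->; case: (ord2P j) => ->; rewrite /= ?mulr1n ?mulr0n -?D1; ring.
Qed.

(** Minus the Hessian of log D, for D = det Y = xy + yz + zx. *)
Lemma ds2_inv_theta (x y z a b c a' b' c' : R) :
  let D := x * y + y * z + z * x in D != 0 ->
  ds2_inv (theta_form x y z) (theta_form a b c) (theta_form a' b' c') =
    (a * (y + z) + b * (x + z) + c * (x + y)) *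
    (a' * (y + z) + b' * (x + z) + c' * (x + y)) / D ^+ 2
    - (a * b' + a' * b + b * c' + b' * c + c * a' + c' * a) / D.
Proof.
move=> D D0; rewrite /ds2_inv theta_form_inv //.
rewrite /mxtrace !big_ord_recl big_ord0 !mxE !big_ord_recl !big_ord0 !mxE.
rewrite !big_ord_recl !big_ord0 !mxE /= -/D.
rewrite -exprVn; have := divff D0; move: D^-1 => d Dd.
rewrite -[X in _ - X * d]mulr1 -Dd /D.
ring.
Qed.

End PeriodMetric.

Section ThetaPeriod.
Variable R : realType.
Variables s t : 'I_3 -> 'I_2.
Local Notation G := (Graph s t).
Variable h : realization R G -> realization R (rose 2).
Hypothesis mh : marking h.
Hypothesis st : forall e, s e != t e.

(** The signs reorient all edges towards the vertex 0. *)
Lemma theta_cycle (c : 'rV[int]_3) : @cycles G c ->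
  \sum_e (-1) ^+ (s e == 0) * (c 0 e)%:~R = 0 :> R.
Proof.
move=> /(_ 0) /= c0.
have -> : \sum_e (-1) ^+ (s e == 0) * (c 0 e)%:~R =
    \sum_(e | t e == 0) (c 0 e)%:~R - \sum_(e | s e == 0) (c 0 e)%:~R :> R.
  rewrite [X in _ = X - _]big_mkcond [X in _ = _ - X]big_mkcond -sumrB.
  apply: eq_bigr => e _.
  have := st e.
  by case: (ord2P (s e)) => ->; case: (ord2P (t e)) => -> //= _; ring.
by rewrite -!rmorph_sum /= c0 subrr.
Qed.

(** P expresses the chosen basis of cycles in the basis e_0 - e_2, e_1 - e_2. It is
invertible because h maps the chosen cycles to the standard basis. *)
Lemma period_theta : exists2 P : 'M[R]_2, P \in unitmx &
  forall l : 'rV[R]_3, period h l = P *m theta_form (l 0 0) (l 0 1) (l 0 2) *m P^T.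
Proof.
pose sg e : R := (-1) ^+ (s e == 0).
have sg2 e : sg e * sg e = 1 by rewrite /sg; case: (_ == _); ring.
pose b i e : R := sg e * (basis_cycle h i 0 e)%:~R.
have bE i e : (basis_cycle h i 0 e)%:~R = sg e * b i e.
  by rewrite /b mulrA sg2 mul1r.
have b2 i : b i 2 = - b i 0 - b i 1.
  have := theta_cycle (basis_cycleP i mh).1.
  by rewrite sum_ord3 -/(b i 0) -/(b i 1) -/(b i 2) => H; lra.
pose P : 'M[R]_2 := \matrix_(i, k) b i (if k == 0 then 0 else 1).
exists P.
  (* Q is the matrix of h in the basis e_0 - e_2, e_1 - e_2 *)
  pose T e j := sg e * turning j (h \o @on_edge R G e).
  pose Q : 'M[R]_2 := \matrix_(k, j) (T (if k == 0 then 0 else 1) j - T 2 j).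
  suff : P *m Q = 1%:M by case/mulmx1_unit.
  apply/matrixP => i j; rewrite !mxE.
  have := congr1 (fun v : 'rV[R]_2 => v 0 j) (basis_cycleP i mh).2.
  rewrite !mxE eqxx /= eq_sym => <-; rewrite sum_ord3 !big_ord_recl big_ord0 !mxE /=.
  by rewrite !bE b2 /T; ring.
move=> l; apply/matrixP => i j; rewrite !mxE !big_ord_recl !big_ord0 !mxE.
rewrite !big_ord_recl !big_ord0 !mxE /= /length_form sum_ord3 !bE !b2.
have E e (x y z : R) : x * (sg e * y) * (sg e * z) = x * y * z.
  by rewrite -[RHS]mul1r -(sg2 e); ring.
by clearbody b; rewrite !E; ring.
Qed.

(** Determinant of the metric in the coordinates x, y. Writing the metric as
(dD)^2 / D^2 + (1 + 1/D) M with M the flat part, the first term is the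
determinant of the second summand and the other one the contribution of the
rank one summand. *)
Definition theta_gram (x y z : R) : R :=
  let D := x * y + y * z + z * x in
  3 * (1 + D^-1) ^+ 2 +
  2 * (1 + D^-1) * ((z - x) ^+ 2 - (z - x) * (z - y) + (z - y) ^+ 2) / D ^+ 2.

Lemma theta_gramE (p : R * R) :
  let x := p.1 in let y := p.2 in let z := 1 - p.1 - p.2 in
  x * y + y * z + z * x != 0 ->
  \det (\matrix_(a < 2, b < 2) ds2 h (chart G p) (frame R G a) (frame R G b)) =
  theta_gram x y z.
Proof.
move=> x y z D0; have [P uP HP] := period_theta.
have uT : theta_form (chart G p 0 0) (chart G p 0 1) (chart G p 0 2) \in unitmx.
  rewrite unitmxE det_mx2 !mxE /= -/x -/y -/z unitfE.
  by apply: contraNneq D0 => <-; apply/eqP; ring.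
rewrite det_mx2 !mxE /ds2 !dperiodE !HP !ds2_inv_congr // !mxE /=.
rewrite -/x -/y -/z !ds2_inv_theta // !sum_ord3 !mxE /=.
rewrite /theta_gram.
move: D0; set D := x * y + _ + _ => D0.
rewrite -!exprVn; move: D^-1 => d.
ring.
Qed.

End ThetaPeriod.

(** * Integrability *)

Section Integrability.
Variable R : realType.
Local Notation mu := (@lebesgue_measure R).

(** The integral of a nonnegative function is a supremum over the simple functions
below it, so that a pointwise comparison is enough. *)
Lemma ge0_integral_leT d (T : measurableType d) (m : {measure set T -> \bar R})
    (D : set T) (f g : T -> \bar R) :
  (forall x, D x -> (0 <= f x <= g x)%E) -> (forall x, (0 <= g x)%E) ->
  (\int[m]_(x in D) f x <= \int[m]_x g x)%E.
Proof.
move=> fg g0; rewrite ge0_integralE; last by move=> x /fg /andP[].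
rewrite ge0_integralTE //; apply: le_ereal_sup => _ [k /= kf <-].
exists k => //= x; apply: le_trans (kf x) _; rewrite /patch.
by case: ifPn => [/set_mem /fg /andP[]|_].
Qed.

(** Up to a factor 2 this dominates (x (1 - x))^(-3/4) on the unit interval, and
unlike that product it has an elementary primitive. *)
Definition edge_weight (x : R) : R := x `^ (- (3 / 4)) + (1 - x) `^ (- (3 / 4)).

Lemma edge_weight_ge0 x : 0 <= edge_weight x.
Proof. by rewrite addr_ge0 // powR_ge0. Qed.

Lemma measurable_edge_weight : measurable_fun setT edge_weight.
Proof.
apply: measurable_funD; first exact: measurable_powR.
apply: (@measurableT_comp _ _ _ _ _ _
  (fun y : R => y `^ (- (3 / 4))) _ (fun x : R => 1 - x)).
  exact: measurable_powR.
by apply: measurable_funB => //; exact: measurable_cst.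
Qed.

Definition edge_weight_prim (x : R) : R := 4 * x `^ 4^-1 - 4 * (1 - x) `^ 4^-1.

Lemma is_derive_edge_weight_prim (x : R) : 0 < x < 1 ->
  is_derive x 1 edge_weight_prim (edge_weight x).
Proof.
move=> /andP[x0 x1]; have x1' : 0 < 1 - x by rewrite subr_gt0.
have d1 := is_derive1_powR 4^-1 x0.
have d2 := is_derive1_powR 4^-1 x1'.
have d3 : is_derive x 1 (fun y : R => 1 - y) (-1).
  have -> : (fun y : R => 1 - y) = cst 1 - id by [].
  by apply: is_derive_eq; rewrite sub0r.
have d4 := @is_derive1_comp R (fun y : R => y `^ 4^-1) (fun y : R => 1 - y) x _ _ d2 d3.
have -> : edge_weight_prim = (4 \*: (fun y : R => y `^ 4^-1)) -
    (4 \*: ((fun y : R => y `^ 4^-1) \o (fun y : R => 1 - y))).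
  by apply/funext => y.
apply: is_derive_eq.
rewrite /edge_weight /GRing.scale /=.
have -> : 4^-1 - 1 = - (3 / 4) :> R by field.
by field.
Qed.

Lemma edge_weight_continuous (x : R) : 0 < x < 1 -> {for x, continuous edge_weight}.
Proof.
move=> /andP[x0 x1]; have x1' : 0 < 1 - x by rewrite subr_gt0.
have c (y : R) : 0 < y -> {for y, continuous (fun z : R => z `^ (- (3 / 4)))}.
  move=> y0; apply: differentiable_continuous; apply/derivable1_diffP.
  by apply: derivable_powR; rewrite in_itv /= y0.
apply: cvgD; first exact: c.
apply: (@continuous_comp _ _ _ (fun y : R => 1 - y) 
  (fun z : R => z `^ (- (3 / 4)))); last exact: c.
by apply: cvgB; [exact: cvg_cst|exact: cvg_id].
Qed.

Lemma integral_edge_weight_segment (a : R) : 0 < a < 2^-1 ->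
  (\int[mu]_(x in `[a, (1 - a)%R]) (edge_weight x)%:E <= 8%:E)%E.
Proof.
move=> /andP[a0 a2].
have in01 (x : R) : a <= x <= 1 - a -> 0 < x < 1.
  by move=> /andP[ax xa]; apply/andP; split; lra.
have cF (x : R) : 0 < x < 1 -> {for x, continuous edge_weight_prim}.
  move=> /is_derive_edge_weight_prim dx; apply: differentiable_continuous.
  by apply/derivable1_diffP; exact: ex_derive.
rewrite (@continuous_FTC2 _ _ edge_weight_prim).
- rewrite -EFinB lee_fin /edge_weight_prim.
  have pa : 0 <= a `^ 4^-1 by exact: powR_ge0.
  have pb : (1 - a) `^ 4^-1 <= 1.
    apply: (@le_trans _ _ (1 `^ 4^-1)); last by rewrite powR1.
    apply: ge0_ler_powR; rewrite ?nnegrE ?invr_ge0 //; lra.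
  rewrite (_ : 1 - (1 - a) = a); last by ring.
  by lra.
- lra.
- apply: continuous_in_subspaceT => x /set_mem; rewrite /= in_itv /= => xin.
  by apply: edge_weight_continuous; exact: in01.
- split.
  + move=> x; rewrite in_itv /= => /andP[ax xa].
    have /is_derive_edge_weight_prim dx : 0 < x < 1 by apply: in01; rewrite !ltW.
    exact: ex_derive.
  + by apply: cvg_at_right_filter; apply: cF; apply: in01; apply/andP; split; lra.
  + by apply: cvg_at_left_filter; apply: cF; apply: in01; apply/andP; split; lra.
- move=> x; rewrite in_itv /= => /andP[ax xa].
  have /is_derive_edge_weight_prim dx : 0 < x < 1 by apply: in01; rewrite !ltW.
  by rewrite derive1E derive_val.
Qed.

(** Exhaust the open interval by the segments [a, 1 - a], on which the primitive
gives a uniform bound. *)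
Lemma integral_edge_weight :
  (\int[mu]_(x in `]0%R, 1%R[) (edge_weight x)%:E <= 8%:E)%E.
Proof.
pose a n : R := n.+3%:R^-1.
have a0 n : 0 < a n by rewrite invr_gt0 ltr0Sn.
have a2 n : a n < 2^-1 by rewrite ltf_pV2 ?posrE ?ltr0Sn // ltr_nat.
pose E n : set R := [set` `[a n, 1 - a n]].
have nE : nondecreasing_seq E.
  move=> m n mn; apply/subsetPset => x; rewrite /E /= !in_itv /= => /andP[ax xa].
  have : a n <= a m by rewrite lef_pV2 ?posrE ?ltr0Sn // ler_nat.
  by move=> h; apply/andP; split; lra.
have UE : `]0, 1[%classic = \bigcup_n E n.
  apply/seteqP; split=> x.
    rewrite /= in_itv /= => /andP[x0 x1].
    have m0 : 0 < Num.min x (1 - x) by rewrite lt_min x0 subr_gt0.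
    have [N _ /(_ N (leqnn _)) /= HN] := near_infty_natSinv_lt (PosNum m0).
    have aN : a N < Num.min x (1 - x).
      by apply: le_lt_trans HN; rewrite /a lef_pV2 ?posrE ?ltr0Sn // ler_nat; lia.
    exists N => //; rewrite /E /= in_itv /=; move: aN; rewrite lt_min => /andP[? ?].
    by apply/andP; split; lra.
  move=> [n _]; rewrite /E /= !in_itv /= => /andP[ax xa].
  by have := a0 n => h; apply/andP; split; lra.
rewrite UE.
have mw : measurable_fun setT (EFin \o edge_weight).
  by apply/measurable_EFinP; exact: measurable_edge_weight.
have C : (\int[mu]_(x in E i) (EFin \o edge_weight) x @[i --> \oo] -->
    \int[mu]_(x in \bigcup_i E i) (EFin \o edge_weight) x)%E.
  apply: ge0_nondecreasing_set_cvg_integral => //.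
  - by move=> i; exact: measurable_itv.
  - by move=> i; exact: measurable_funTS.
  - by move=> i x _; rewrite lee_fin edge_weight_ge0.
rewrite -(cvg_lim _ C) //; apply: lime_le; first by apply/cvg_ex; eexists; exact: C.
by apply: nearW => n; apply: integral_edge_weight_segment; rewrite a0 a2.
Qed.

Definition edge_weight01 : R -> R := edge_weight \_ `]0, 1[.

Lemma edge_weight01_ge0 x : 0 <= edge_weight01 x.
Proof.
by rewrite /edge_weight01 /patch; case: ifP => // _; exact: edge_weight_ge0.
Qed.

Lemma measurable_edge_weight01 : measurable_fun setT edge_weight01.
Proof.
apply/(measurable_restrictT _ _).1; first exact: measurable_itv.
by apply: measurable_funTS; exact: measurable_edge_weight.
Qed.

Lemma measurable_edge_weight_square :
  measurable_fun setT (fun p : R * R => edge_weight01 p.1 * edge_weight01 p.2).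
Proof.
apply: measurable_funM.
  by apply: (measurableT_comp measurable_edge_weight01); exact: measurable_fst.
by apply: (measurableT_comp measurable_edge_weight01); exact: measurable_snd.
Qed.

Local Open Scope ereal_scope.

Lemma integral_edge_weight_square :
  \int[mu \x mu]_p (edge_weight01 p.1 * edge_weight01 p.2)%:E <= 64%:E.
Proof.
pose w := edge_weight01.
have w0 x : (0 <= w x)%R by exact: edge_weight01_ge0.
have mw : measurable_fun setT w by exact: measurable_edge_weight01.
have mwE : measurable_fun setT (EFin \o w) by exact/measurable_EFinP.
have Iw : \int[mu]_x (w x)%:E <= 8%:E.
  have -> : \int[mu]_x (w x)%:E = \int[mu]_(x in `]0%R, 1%R[) (edge_weight x)%:E.
    rewrite [RHS]integral_mkcond; apply: eq_integral => x _.
    by rewrite /w /edge_weight01 restrict_EFin.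
  exact: integral_edge_weight.
have Iw0 : 0 <= \int[mu]_x (w x)%:E by apply: integral_ge0 => x _; rewrite lee_fin.
rewrite fubini_tonelli1 /=; last 2 first.
- by apply/measurable_EFinP; exact: measurable_edge_weight_square.
- by move=> p; rewrite lee_fin mulr_ge0.
rewrite /fubini_F /=.
under eq_integral => x _.
  under eq_integral do rewrite EFinM.
  rewrite ge0_integralZl_EFin //; last by move=> y _; rewrite lee_fin.
  over.
rewrite ge0_integralZr //; last by move=> x _; rewrite lee_fin.
have -> : 64%:E = 8%:E * 8%:E :> \bar R by rewrite -EFinM -natrM.
exact: lee_pmul.
Qed.

End Integrability.

(** * The area of a 2-simplex *)

Section AreaBound.
Variable R : realType.

(** With d = 1/D >= 1 and the quadratic form q at most 3, the two terms are at most
12 d^2 and 12 d^3; 24 is rounded up to a square. *)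
Lemma theta_gram_le (x y z : R) : 0 < x -> 0 < y -> 0 < z -> x + y + z = 1 ->
  theta_gram x y z <= 25 * (x * y + y * z + z * x)^-1 ^+ 3.
Proof.
move=> x0 y0 z0 s1; rewrite /theta_gram -exprVn.
have D0 : 0 < x * y + y * z + z * x by rewrite !addr_gt0 ?mulr_gt0.
have D1 : x * y + y * z + z * x <= 1.
  have : (x + y + z) ^+ 2 = 1 by rewrite s1 expr1n.
  by have := mulr_gt0 x0 y0; have := mulr_gt0 y0 z0; have := mulr_gt0 z0 x0; nra.
have d1 : 1 <= (x * y + y * z + z * x)^-1 by rewrite invf_ge1.
move: (_^-1) d1 => d d1 {D0 D1}.
have [a1 b1] : -1 <= z - x <= 1 /\ -1 <= z - y <= 1.
  by split; apply/andP; split; lra.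
have {a1 b1}/andP[q0 q3] : 0 <= (z - x) ^+ 2 - (z - x) * (z - y) + (z - y) ^+ 2 <= 3.
  move: (z - x) (z - y) a1 b1 => a b /andP[a0 a1] /andP[b0 b1].
  have := sqr_ge0 (a - b); have := sqr_ge0 (a + b).
  have := sqr_ge0 a; have := sqr_ge0 b.
  have : a ^+ 2 <= 1 by nra.
  have : b ^+ 2 <= 1 by nra.
  by move=> *; apply/andP; split; lra.
move: (_ - _ + _) q0 q3 => q q0 q3.
have d2 : 0 <= d ^+ 2 by exact: sqr_ge0.
have e1 : (1 + d) ^+ 2 <= 4 * d ^+ 2 by nra.
have e2 : d ^+ 2 <= d ^+ 3 by rewrite exprS ler_peMl.
have e3 : (1 + d) * d ^+ 2 <= 2 * d ^+ 3.
  by rewrite [d ^+ 3]exprS mulrA; apply: ler_wpM2r => //; lra.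
have e4 : (1 + d) * d ^+ 2 * q <= 2 * d ^+ 3 * 3.
  by apply: ler_pM => //; apply: mulr_ge0 => //; lra.
have -> : 2 * (1 + d) * q * d ^+ 2 = 2 * ((1 + d) * d ^+ 2 * q) by ring.
by lra.
Qed.

(** One of x and 1 - x is at least 1/2, and 2^(3/4) <= 2. *)
Lemma powR_inv_le_edge_weight (x D : R) : 0 < x < 1 -> x * (1 - x) <= D ->
  D^-1 `^ (3 / 4) <= 2 * edge_weight x.
Proof.
wlog : x / x <= 2^-1 => [W xin xD|x2 /andP[x0 x1] xD].
  have [x2|/ltW x2] := leP x 2^-1; first exact: W.
  have -> : edge_weight x = edge_weight (1 - x).
    by rewrite /edge_weight addrC opprB addrCA subrr addr0.
  apply: W; [lra| |by rewrite opprB addrCA subrr addr0 mulrC].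
  by case/andP: xin => ? ?; apply/andP; split; lra.
have x1' : 0 < 1 - x by lra.
have X0 : 0 < x * (1 - x) by rewrite mulr_gt0.
have p34 : 0 <= 3 / 4 :> R by lra.
have : D^-1 <= x^-1 * 2.
  rewrite -[2]invrK -invfM lef_pV2 ?posrE; first by nra.
    exact: lt_le_trans X0 xD.
  by rewrite mulr_gt0 // invr_gt0.
have Di0 : 0 <= D^-1 by rewrite invr_ge0 ltW // (lt_le_trans X0 xD).
move=> /(ge0_ler_powR p34) le1; apply: le_trans (le1 _ _) _; rewrite ?nnegrE //.
  by rewrite mulr_ge0 // invr_ge0 ltW.
rewrite powRM ?invr_ge0 ?(ltW x0) //.
have -> : x^-1 `^ (3 / 4) = x `^ (- (3 / 4)).
  by rewrite -powR_inv1 ?(ltW x0) // -powRrM mulN1r.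
have t2 : 2 `^ (3 / 4) <= 2 :> R.
  apply: (@le_trans _ _ (2 `^ 1)); last by rewrite powRr1.
  by apply: ler_powR; lra.
have a0 : 0 <= x `^ (- (3 / 4)) by exact: powR_ge0.
have b0 : 0 <= (1 - x) `^ (- (3 / 4)) by exact: powR_ge0.
rewrite /edge_weight; apply: (@le_trans _ _ (x `^ (- (3 / 4)) * 2)).
  exact: ler_wpM2l.
lra.
Qed.

(** D^(-3/2) is split evenly between x and y: both exponents stay above -1, which
keeps the two factors integrable. *)
Lemma sqrt_theta_gram_le (x y z : R) : 0 < x -> 0 < y -> 0 < z -> x + y + z = 1 ->
  Num.sqrt (theta_gram x y z) <= 20 * (edge_weight x * edge_weight y).
Proof.
move=> x0 y0 z0 s1; have x1 : 0 < x < 1 by apply/andP; split; lra.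
have y1 : 0 < y < 1 by apply/andP; split; lra.
have zE : z = 1 - x - y by lra.
set D := x * y + y * z + z * x.
have D0 : 0 < D by rewrite !addr_gt0 ?mulr_gt0.
have Di0 : 0 <= D^-1 by rewrite invr_ge0 ltW.
(* D = x (1 - x) + yz = y (1 - y) + xz *)
have wx : D^-1 `^ (3 / 4) <= 2 * edge_weight x.
  by apply: powR_inv_le_edge_weight => //; rewrite /D zE; nra.
have wy : D^-1 `^ (3 / 4) <= 2 * edge_weight y.
  by apply: powR_inv_le_edge_weight => //; rewrite /D zE; nra.
apply: (@le_trans _ _ (5 * (D^-1 `^ (3 / 4) * D^-1 `^ (3 / 4)))); last first.
  have := ler_pM (powR_ge0 _ _) (powR_ge0 _ _) wx wy.
  by rewrite mulrACA -natrM; lra.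
have E : (5 * (D^-1 `^ (3 / 4) * D^-1 `^ (3 / 4))) ^+ 2 = 25 * D^-1 ^+ 3.
  rewrite -powRD; last by apply/implyP => _; rewrite invr_eq0 gt_eqF.
  rewrite exprMn -natrX; congr (_ * _).
  rewrite -powR_mulrn ?powR_ge0 // -powRrM -powR_mulrn //.
  by congr (_ `^ _); field.
rewrite -(ger0_norm (_ : 0 <= 5 * _)); last by rewrite mulr_ge0 // mulr_ge0 // powR_ge0.
by rewrite -sqrtr_sqr ler_sqrt E; [exact: theta_gram_le|rewrite mulr_ge0 // exprn_ge0].
Qed.

Local Open Scope ereal_scope.

Lemma area_ge0 n (G : graph) (h : realization R G -> realization R (rose n)) :
  0 <= area h.
Proof. by apply: integral_ge0 => p _; rewrite lee_fin sqrtr_ge0. Qed.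

(** The constant is 20 * 8 * 8, each factor 8 bounding the integral of
[edge_weight]. *)
Lemma area_theta_le (s t : 'I_3 -> 'I_2)
    (h : realization R (Graph s t) -> realization R (rose 2)) :
  marking h -> (forall e, s e != t e) -> area h <= 1280%:E.
Proof.
move=> mh st; pose w (p : R * R) : R := (edge_weight01 p.1 * edge_weight01 p.2)%R.
have w0 p : (0 <= w p)%R by rewrite mulr_ge0 // edge_weight01_ge0.
apply: (@le_trans _ _ (\int[@lebesgue_measure R \x @lebesgue_measure R]_p
    (20%:E * (w p)%:E))).
  apply: ge0_integral_leT => [p [pos _]|p]; last by rewrite -EFinM lee_fin mulr_ge0.
  have := pos (Ordinal (isT : (2 < 3)%N)); have := pos (Ordinal (isT : (1 < 3)%N)).
  have := pos (Ordinal (isT : (0 < 3)%N)); rewrite !mxE /= => x0 y0 z0.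
  rewrite lee_fin sqrtr_ge0 -EFinM lee_fin /=.
  rewrite (theta_gramE mh st); last by rewrite gt_eqF // !addr_gt0 // mulr_gt0.
  apply: (le_trans (sqrt_theta_gram_le x0 y0 z0 _)); first by ring.
  rewrite ler_pM2l // /w /edge_weight01 /patch !mem_set //= in_itv /=.
    by apply/andP; split; lra.
  by apply/andP; split; lra.
rewrite ge0_integralZl_EFin //; last 2 first.
- by move=> p _; rewrite lee_fin.
- by apply/measurable_EFinP; exact: measurable_edge_weight_square.
have -> : 1280%:E = 20%:E * 64%:E :> \bar R by rewrite -EFinM -natrM.
by apply: lee_wpmul2l; [rewrite lee_fin|exact: integral_edge_weight_square].
Qed.

(** The rank excludes a single vertex, and admissibility then leaves only theta
graphs. *)
Lemma area_le (G : graph) (h : realization R G -> realization R (rose 2)) :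
  nE G = 3%N -> marked_graph h -> area h <= 1280%:E.
Proof.
move=> E3 [aG mh].
have V1 : nV G <> 1%N.
  by move=> V1; have := marked_rose_edges mh V1; rewrite E3.
have [V2 st] := admissible_theta aG E3 V1.
case: G h E3 {aG} mh V1 V2 st => V E s t h /= E3 mh _ V2 st.
subst E V; exact: area_theta_le.
Qed.

End AreaBound.

(** * Finiteness of the volume *)

Section FinitelyManyOrbits.
Variable R : realType.

(** The orbits are indexed by the pairs of attaching maps of the three edges to the
two vertices. *)
Lemma finite_simplex_orbits :
  finite_set [set simplex_orbit S | S in @two_simplices R 2].
Proof.
pose F (st : ('I_3 -> 'I_2) * ('I_3 -> 'I_2)) :=
  [set simplex k | k in @marked_graph R 2 (Graph st.1 st.2)].
pose c (u : {ffun 'I_3 -> 'I_2} * {ffun 'I_3 -> 'I_2}) :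
  ('I_3 -> 'I_2) * ('I_3 -> 'I_2) := (fun e => u.1 e, fun e => u.2 e).
apply: (@sub_finite_set _ _ [set F (c u) | u in setT]); last first.
  by apply: finite_image; exact: finite_finset.
move=> _ [_ [G [h [E3 mh ->]] <-]]; rewrite simplex_orbitE //.
have V1 : nV G <> 1%N.
  by move=> V1; have := marked_rose_edges mh.2 V1; rewrite E3.
have [V2 _] := admissible_theta mh.1 E3 V1.
case: G h E3 mh V1 V2 => V E s t h /= E3 mh _ V2; subst E V.
exists (finfun s, finfun t) => //; rewrite /F /c /=.
have ffunK (f : 'I_3 -> 'I_2) : (fun e => finfun f e) = f.
  by apply/funext => e; rewrite ffunE.
by rewrite !ffunK.
Qed.

Local Open Scope ereal_scope.

Lemma simplex_area_le (S : set (set (metric_triple R 2))) :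
  simplex_area S <= 1280%:E.
Proof. by apply: ge_ereal_sup => _ [G [h [E3 mh _ ->]]]; exact: area_le. Qed.

Lemma simplex_area_ge0 (S : set (set (metric_triple R 2))) :
  two_simplices S -> 0 <= simplex_area S.
Proof.
move=> [G [h [E3 mh SE]]]; apply: (le_trans (area_ge0 h)).
by apply: ereal_sup_ubound; exists G, h.
Qed.

Lemma orbit_area_bound (S : set (set (metric_triple R 2))) :
  two_simplices S -> 0 <= orbit_area (simplex_orbit S) <= 1280%:E.
Proof.
move=> [G [h [E3 mh SE]]]; apply/andP; split; last first.
  by apply: ge_ereal_sup => _ [S' _ <-]; exact: simplex_area_le.
apply: (@le_trans _ _ (simplex_area S)).
  by apply: simplex_area_ge0; exists G, h.
apply: ereal_sup_ubound; exists S => //.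
by rewrite SE simplex_orbitE //; exists h.
Qed.

End FinitelyManyOrbits.

Theorem proposition11p2 (R : realType) :
  (forall S : set (set (metric_triple R 2)),
     two_simplices S -> simplex_area S \is a fin_num) /\
  quotient_volume R \is a fin_num.
Proof.
have fin (x : \bar R) : (0 <= x <= 1280%:E)%E -> x \is a fin_num.
  by move=> /andP[x0 x1]; rewrite ge0_fin_numE // (le_lt_trans x1) // ltry.
split=> [S tS|]; first by apply: fin; rewrite simplex_area_ge0 // simplex_area_le.
have bound O : [set simplex_orbit S | S in @two_simplices R 2] O ->
    (0 <= orbit_area O <= 1280%:E)%E.
  by move=> [S tS <-]; exact: orbit_area_bound.
rewrite /quotient_volume esum_fset; first last.
- by move=> O /set_mem /bound /andP[].
- exact: finite_simplex_orbits.
rewrite fsbig_finite; last exact: finite_simplex_orbits.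
apply/sum_fin_numP => O; rewrite in_fset_set; last exact: finite_simplex_orbits.
by move=> /set_mem /bound /fin.
Qed.
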